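(* Let $(\bar x,\bar y)\in\Omega_{GE}$ and assume (see context for all notation): (1) the tangent cone $T_C(\bar x)$ is convex and $T_D(F(\bar x,\bar y))=T_C(\bar x)\times T_{{\rm gph}\,\widehat N_\Gamma}(\bar y,-G(\bar x,\bar y))$; (2) GGCQ holds at $(\bar x,\bar y)$; (3) there is some $v\in\mathbb{R}^m$ such that $\nabla g_i(\bar y)v<0$ for all $i\in\bar{\mathcal I}$ (MFCQ at $\bar y$); and in addition that $T_C(\bar x)$ is polyhedral and $\bar\Lambda(v_1)=\bar\Lambda(v_2)$ for all $0\ne v_1,v_2\in\bar K$. Let $\bar\lambda$ be an arbitrarily fixed multiplier from $\bar\Lambda(v)$ for some $0\ne v\in\bar K$ if $\bar K\ne\{0\}$, and $\bar\lambda\in\bar\Lambda$ otherwise. Then for all index sets $\beta_1,\beta_2\subset\bar I^0$ we have $$\widehat N_{\Omega_{GE}}(\bar x,\bar y)\subset \nabla F(\bar x,\bar y)^T\tilde N^{\beta_1,\beta_2}_{GE}=\left\{\left(\begin{array}{c} \eta_C -\nabla_xG(\bar x,\bar y)^Tq \\ {q^\ast}-\nabla_yG(\bar x,\bar y)^Tq \end{array}\right)\ \Big|\ (\eta_C,q^\ast,q)\in\tilde N^{\beta_1,\beta_2}_{GE}\right\},$$ where $\tilde N^{\beta_1,\beta_2}_{GE}$ is the set of all $(\eta_C,q^\ast,q)\in\widehat N_C(\bar x)\times\mathbb{R}^m\times\mathbb{R}^m$ for which there exist $r\in\mathbb{R}^m$ and reals $\mu_i^r,\mu_i^q$, $i\in\bar{\mathcal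 I}$, such that \begin{align*} &q^\ast+\nabla^2(\bar\lambda^Tg)(\bar y)q=\sum_{i\in\bar{\mathcal I}}\mu_i^q\nabla g_i(\bar y),\\ &\nabla g_i(\bar y)q=0,\ i\in\bar I^+,\quad \nabla g_i(\bar y)q\leq 0,\ i\in\beta_1,\quad \mu_i^q\geq 0,\ i\in\bar I^0\setminus \beta_1,\\ &\nabla g_i(\bar y)r=0,\ i\in\bar I^+,\quad \nabla g_i(\bar y)q\leq \nabla g_i(\bar y)r,\ i\in\beta_2,\quad \mu_i^q\geq \mu_i^r,\ i\in\bar I^0\setminus \beta_2,\\ &\nabla_y G(\bar x,\bar y)^Tr+\nabla^2(\bar\lambda^Tg)(\bar y)r=\sum_{i\in\bar{\mathcal I}}\mu_i^r\nabla g_i(\bar y),\\ &\eta_C\in \nabla_x G(\bar x,\bar y)^Tr+\widehat N_C(\bar x). \end{align*}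
   Context: For $\Theta\subset\mathbb{R}^d$, $\bar z\in\Theta$: $T_\Theta(\bar z)=\{u\mid \exists t_k\searrow 0,\ u_k\to u:\ \bar z+t_ku_k\in\Theta\ \forall k\}$, $\widehat N_\Theta(\bar z)=(T_\Theta(\bar z))^\circ$, where $K^\circ=\{z^*\mid \langle z^*,u\rangle\le 0\ \forall u\in K\}$; $\widehat N_\Theta(\bar z)=\emptyset$ if $\bar z\notin\Theta$. Setting: $G:\mathbb{R}^n\times\mathbb{R}^m\to\mathbb{R}^m$ is continuously differentiable, $C\subset\mathbb{R}^n$ is closed, $g:\mathbb{R}^m\to\mathbb{R}^l$ is twice continuously differentiable, $\Gamma=\{y\in\mathbb{R}^m\mid g_i(y)\le 0,\ i=1,\ldots,l\}$, ${\rm gph}\,\widehat N_\Gamma=\{(y,y^* )\mid y^*\in\widehat N_\Gamma(y)\}$, and $$\Omega_{GE}=\{(x,y)\mid 0\in G(x,y)+\widehat N_\Gamma(y),\ x\in C\}=\{(x,y)\mid F(x,y)\in D\},$$ with $F(x,y)=(x,(y,-G(x,y)))$, $D=C\times{\rm gph}\,\widehat N_\Gamma$. GGCQ at $(\bar x,\bar y)$: $(T_{\Omega_{GE}}(\bar x,\bar y))^\circ=\{(u,v)\mid\nabla F(\bar x,\bar y)(u,v)\in T_D(F(\bar x,\bar y))\}^\circ$. Notation: $\bar y^*=-G(\bar x,\bar y)$; $\bar{\mathcal I}=\{i\mid g_i(\bar y)=0\}$; $\bar\Lambda=\{\lambda\in\widehat N_{\mathbb{R}^l_-}(g(\bar y))\mid\nabla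 g(\bar y)^T\lambda=\bar y^*\}$; $\bar K=T_\Gamma(\bar y)\cap(\bar y^* )^\perp$; $I^+(\lambda)=\{i\mid\lambda_i>0\}$; $\bar I^+=\bigcup_{\lambda\in\bar\Lambda}I^+(\lambda)$; $\bar I^0=\bar{\mathcal I}\setminus\bar I^+$; for $v\in\bar K$, $\bar\Lambda(v)=\mathop{\rm arg\,max}_{\lambda\in\bar\Lambda}v^T\nabla^2(\lambda^Tg)(\bar y)v$. $\nabla g_i(\bar y)$ acts on vectors by inner product and is also regarded as a vector in $\mathbb{R}^m$. *)

(* Defs.v *)
From mathcomp Require Export all_boot all_order all_algebra.
From mathcomp Require Export all_classical all_reals all_analysis.
Export Order.TTheory GRing.Theory Num.Theory.
Export numFieldNormedType.Exports.

Set Implicit Arguments.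
Unset Strict Implicit.
Unset Printing Implicit Defensive.

Local Open Scope classical_set_scope.
Local Open Scope ring_scope.

(* Elements of R^d are row vectors 'rV[R]_d, and R^a x R^b is 'rV[R]_(a + b) via
   row_mx. In the library's row convention 'J f p : 'M_(a, b) is the transpose
   of the usual Jacobian of f : R^a -> R^b: the derivative applied to v is
   v *m 'J f p, and the transposed derivative applied to w is w *m ('J f p)^T. *)

Section VariationalAnalysis.
Context {R : realType}.

Definition dot {d : nat} (u v : 'rV[R]_d) : R := (u *m v^T) 0 0.

Definition prodset {a b : nat} (A : set 'rV[R]_a) (B : set 'rV[R]_b) :
    set 'rV[R]_(a + b) :=
  [set w | A (lsubmx w) /\ B (rsubmx w)].

(* t_k decreases to 0 in the usual sense of variational analysis:
   t_k > 0 and t_k --> 0. *)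
Definition tangent_cone {d : nat} (Theta : set 'rV[R]_d) (z : 'rV[R]_d) :
    set 'rV[R]_d :=
  [set u | exists (t : nat -> R) (u_ : nat -> 'rV[R]_d),
     [/\ forall k, 0 < t k, t k @[k --> \oo] --> 0, u_ k @[k --> \oo] --> u
       & forall k, Theta (z + t k *: u_ k)]].

Definition polar {d : nat} (K : set 'rV[R]_d) : set 'rV[R]_d :=
  [set w | forall u, K u -> dot w u <= 0].

Definition regular_normal_cone {d : nat} (Theta : set 'rV[R]_d)
    (z : 'rV[R]_d) : set 'rV[R]_d :=
  [set w | Theta z /\ polar (tangent_cone Theta z) w].

Definition orthogonal_complement {d : nat} (w : 'rV[R]_d) : set 'rV[R]_d :=
  [set u | dot w u = 0].

Definition polyhedral {d : nat} (A : set 'rV[R]_d) : Prop :=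
  exists (k : nat) (a : 'I_k -> 'rV[R]_d) (b : 'I_k -> R),
    A = [set u | forall i, dot (a i) u <= b i].

Definition C1 {a b : nat} (f : 'rV[R]_a -> 'rV[R]_b) : Prop :=
  (forall z, differentiable f z) /\ continuous (fun z => 'J f z).

Definition grad {d : nat} (f : 'rV[R]_d -> R) (z : 'rV[R]_d) : 'rV[R]_d :=
  \row_j 'd f z (delta_mx 0 j).

Definition hess {d : nat} (f : 'rV[R]_d -> R) (z : 'rV[R]_d) : 'M[R]_d :=
  'J (grad f) z.

Definition C2 {a b : nat} (f : 'rV[R]_a -> 'rV[R]_b) : Prop :=
  C1 f /\ forall i, C1 (grad (fun z => f z 0 i)).

Section Constraints.
Context {m l : nat} (g : 'rV[R]_m -> 'rV[R]_l).

Definition Gamma : set 'rV[R]_m := [set y | forall i, g y 0 i <= 0].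

Definition gphN : set 'rV[R]_(m + m) :=
  [set w | regular_normal_cone Gamma (lsubmx w) (rsubmx w)].

Definition nonpos_orthant : set 'rV[R]_l := [set z | forall i, z 0 i <= 0].

Definition grad_g (i : 'I_l) (y : 'rV[R]_m) : 'rV[R]_m :=
  grad (fun z => g z 0 i) y.

Definition hess_lag (lam : 'rV[R]_l) (y : 'rV[R]_m) : 'M[R]_m :=
  hess (fun z => dot lam (g z)) y.

Definition active (y : 'rV[R]_m) : set 'I_l := [set i | g y 0 i = 0].

Definition MFCQ (y : 'rV[R]_m) : Prop :=
  exists v, forall i, active y i -> dot (grad_g i y) v < 0.

(* In the remaining definitions ys is the fixed normal vector y*. *)
Definition multipliers (y ys : 'rV[R]_m) : set 'rV[R]_l :=
  [set lam | regular_normal_cone nonpos_orthant (g y) lam /\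
             lam *m ('J g y)^T = ys].

Definition critical_cone (y ys : 'rV[R]_m) : set 'rV[R]_m :=
  tangent_cone Gamma y `&` orthogonal_complement ys.

Definition Iplus (y ys : 'rV[R]_m) : set 'I_l :=
  \bigcup_(lam in multipliers y ys) [set i | 0 < lam 0 i].

Definition Izero (y ys : 'rV[R]_m) : set 'I_l :=
  active y `\` Iplus y ys.

Definition dir_multipliers (y ys v : 'rV[R]_m) : set 'rV[R]_l :=
  [set lam | multipliers y ys lam /\
     forall lam', multipliers y ys lam' ->
       dot (v *m hess_lag lam' y) v <= dot (v *m hess_lag lam y) v].

End Constraints.

Section GeneralizedEquation.
Context {n m l : nat}.
Variables (G : 'rV[R]_(n + m) -> 'rV[R]_m) (C : set 'rV[R]_n).
Variable (g : 'rV[R]_m -> 'rV[R]_l).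

Definition OmegaGE : set 'rV[R]_(n + m) :=
  [set z | (exists2 w, regular_normal_cone (Gamma g) (rsubmx z) w
                       & 0 = G z + w)
           /\ C (lsubmx z)].

Definition FGE (z : 'rV[R]_(n + m)) : 'rV[R]_(n + (m + m)) :=
  row_mx (lsubmx z) (row_mx (rsubmx z) (- G z)).

Definition DGE : set 'rV[R]_(n + (m + m)) := prodset C (gphN g).

Lemma OmegaGE_preimage : OmegaGE = FGE @^-1` DGE.
Proof.
apply/seteqP; split=> z; rewrite /OmegaGE /DGE /prodset /gphN /FGE /=;
  rewrite ?row_mxKl ?row_mxKr ?row_mxKl.
- case=> -[w Nw /esym/eqP]; rewrite addrC addr_eq0 => /eqP wE Cz.
  by rewrite -wE.
- by case=> Cz Nz; split=> //; exists (- G z); rewrite ?subrr.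
Qed.

Definition GGCQ (z : 'rV[R]_(n + m)) : Prop :=
  polar (tangent_cone OmegaGE z) =
  polar [set w | tangent_cone DGE (FGE z) ('d FGE z w)].

Definition JxG (x : 'rV[R]_n) (y : 'rV[R]_m) : 'M[R]_(n, m) :=
  'J (fun x' => G (row_mx x' y)) x.

Definition JyG (x : 'rV[R]_n) (y : 'rV[R]_m) : 'M[R]_(m, m) :=
  'J (fun y' => G (row_mx x y')) y.

(* The values of mur and muq outside the active index set are irrelevant. *)
Definition NtildeGE (x : 'rV[R]_n) (y : 'rV[R]_m) (lam : 'rV[R]_l)
    (beta1 beta2 : set 'I_l) : set 'rV[R]_(n + (m + m)) :=
  let ys := - G (row_mx x y) in
  let I := active g y in
  let Ip := Iplus g y ys in
  let I0 := Izero g y ys in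
  let H := hess_lag g lam y in
  [set w | exists (etaC : 'rV[R]_n) (qs q : 'rV[R]_m),
     [/\ w = row_mx etaC (row_mx qs q),
         regular_normal_cone C x etaC
       & exists (r : 'rV[R]_m) (mur muq : 'I_l -> R),
         [/\ qs + q *m H = \sum_(i | i \in I) muq i *: grad_g g i y,
             [/\ forall i, Ip i -> dot (grad_g g i y) q = 0,
                 forall i, beta1 i -> dot (grad_g g i y) q <= 0
               & forall i, (I0 `\` beta1) i -> 0 <= muq i],
             [/\ forall i, Ip i -> dot (grad_g g i y) r = 0,
                 forall i, beta2 i ->
                   dot (grad_g g i y) q <= dot (grad_g g i y) r
               & forall i, (I0 `\` beta2) i -> mur i <= muq i],
             r *m (JyG x y)^T + r *m H
               = \sum_(i | i \in I) mur i *: grad_g g i y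
           & exists2 eta, regular_normal_cone C x eta
                          & etaC = r *m (JxG x y)^T + eta]]].

End GeneralizedEquation.
End VariationalAnalysis.

(* Main.v *)
Require Import Defs.
From mathcomp Require Import ring lra.
Set Implicit Arguments.
Unset Strict Implicit.
Unset Printing Implicit Defensive.
Local Open Scope classical_set_scope.
Local Open Scope ring_scope.

(** The regular normal cone of a set is the polar of its tangent cone, so upper
    estimates of normals come from large convex subsets of tangent cones.

    By the constraint qualification GGCQ, a regular normal [p] of the feasible set
    belongs to the polar of the linearized cone, the preimage under the derivative
    of [FGE G] of the tangent cone of [DGE C g]; by assumption the latter is the
    product of the polyhedral cone [T_C] with the tangent cone of the graph of the
    normal cone map of [Gamma g]. Hence it is enough to exhibit convex polyhedral
    pieces of this graphical tangent cone: the polar of the preimage of such a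
    piece is given by Farkas' lemma ([farkas_mixed]).

    The pieces come from [gphN_tangent]: if [v] is a critical direction, [lam] a
    directional multiplier for [v] and [w] a normal at [v] to the critical cone,
    then [(v, v H + w)], with [H] the Hessian of the Lagrangian, is tangent to the
    graph. To see it, project the point [y + t v + s^-1 (ys + t (v H + w))] onto
    [Gamma g], with [s] large and fixed. The residual of a projection is a normal,
    so everything reduces to showing that the projection is [y + t v + e] with [e]
    of smaller order than [t]. On the one hand the projection does at least as well
    as the arc [y + t v + t^2 z / 2], where [z] is a dual solution of the linear
    program that defines directional multipliers ([second_order_correction]), made
    feasible by the MFCQ direction ([feasible_arc]). On the other hand a Taylor
    expansion of the Lagrangian bounds the objective from below. The two bounds
    coincide up to o(t^2), the product of [t] with [w e], which turns out to be
    negligible, and a positive quadratic term in [e], which must therefore be o(t^2)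
    ([arc_error_bound]).

    As the directional multipliers do not depend on the critical direction, the
    same [lam] serves for all [v]. For a set [beta] of indices that are active but
    in no [I^+], the directions [v] whose constraints vanish on [beta], together
    with the normals having nonnegative weights on [beta] and zero weights on the
    remaining such indices, form a polyhedral piece. Its dual description
    ([normal_piece]) involves the transpose of [H], whence the need for Schwarz'
    theorem ([hess_sym]). Applying it to [beta1] and to [beta2] gives two
    representations of the same normal [p], and subtracting them produces the
    vector [r] and the multipliers [mur] ([normal_cone_sub]). *)


(** * The inner product *)

Section Dot.
Context {R : realType}.
Implicit Types d : nat.

Lemma dotE d (u v : 'rV[R]_d) : dot u v = \sum_i u 0 i * v 0 i.
Proof. by rewrite /dot mxE; apply: eq_bigr => i _; rewrite mxE. Qed.

Lemma dotC d (u v : 'rV[R]_d) : dot u v = dot v u.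
Proof. by rewrite !dotE; apply: eq_bigr => i _; rewrite mulrC. Qed.

Lemma dotDl d (u v w : 'rV[R]_d) : dot (u + v) w = dot u w + dot v w.
Proof. by rewrite /dot mulmxDl mxE. Qed.

Lemma dotZl d (k : R) (u v : 'rV[R]_d) : dot (k *: u) v = k * dot u v.
Proof. by rewrite /dot -scalemxAl mxE. Qed.

Lemma dotNl d (u v : 'rV[R]_d) : dot (- u) v = - dot u v.
Proof. by rewrite /dot mulNmx mxE. Qed.

Lemma dot0l d (v : 'rV[R]_d) : dot 0 v = 0.
Proof. by rewrite /dot mul0mx mxE. Qed.

Lemma dotDr d (u v w : 'rV[R]_d) : dot u (v + w) = dot u v + dot u w.
Proof. by rewrite dotC dotDl !(dotC u). Qed.

Lemma dotZr d (k : R) (u v : 'rV[R]_d) : dot u (k *: v) = k * dot u v.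
Proof. by rewrite dotC dotZl dotC. Qed.

Lemma dotNr d (u v : 'rV[R]_d) : dot u (- v) = - dot u v.
Proof. by rewrite dotC dotNl dotC. Qed.

Lemma dot0r d (v : 'rV[R]_d) : dot v 0 = 0.
Proof. by rewrite dotC dot0l. Qed.

Definition dotW := (dotDl, dotDr, dotZl, dotZr, dotNl, dotNr, @dot0l, @dot0r).

Lemma dot_suml d (I : Type) (r : seq I) (P : pred I) (F : I -> 'rV[R]_d) v :
  dot (\sum_(i <- r | P i) F i) v = \sum_(i <- r | P i) dot (F i) v.
Proof. by rewrite /dot mulmx_suml summxE. Qed.

Lemma dot_mulmx a b (u : 'rV[R]_a) (A : 'M[R]_(a, b)) (v : 'rV[R]_b) :
  dot (u *m A) v = dot u (v *m A^T).
Proof. by rewrite /dot trmx_mul trmxK mulmxA. Qed.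

Lemma dot_row_mx a b (u u' : 'rV[R]_a) (v v' : 'rV[R]_b) :
  dot (row_mx u v) (row_mx u' v') = dot u u' + dot v v'.
Proof. by rewrite /dot tr_row_mx mul_row_col mxE. Qed.

Lemma dot_delta d (u : 'rV[R]_d) j : dot u (delta_mx 0 j) = u 0 j.
Proof.
by rewrite /dot trmx_delta -colE mxE.
Qed.

Lemma dot_ge0 d (u : 'rV[R]_d) : 0 <= dot u u.
Proof. by rewrite dotE sumr_ge0 // => i _; rewrite -expr2 sqr_ge0. Qed.

Lemma dot_eq0 d (u : 'rV[R]_d) : dot u u = 0 -> u = 0.
Proof.
rewrite dotE => /eqP; rewrite psumr_eq0 => [/allP u0|i _]; last first.
  by rewrite -expr2 sqr_ge0.
apply/rowP => i; rewrite mxE; apply/eqP.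
by have /implyP := u0 i (mem_index_enum _); rewrite mulf_eq0 orbb; apply.
Qed.

(** Used in place of the Cauchy-Schwarz inequality: no square root appears, and
    the step length [s] of an arc spreads over the two quadratic terms. *)
Lemma dot_young d (s : R) (u v : 'rV[R]_d) :
  2 * (s * `|dot u v|) <= s ^+ 2 * dot u u + dot v v.
Proof.
have := dot_ge0 (s *: u + v); have := dot_ge0 (s *: u - v).
have -> : dot (s *: u - v) (s *: u - v) =
    s ^+ 2 * dot u u + dot v v - 2 * (s * dot u v).
  by rewrite !dotW (dotC v u); ring.
have -> : dot (s *: u + v) (s *: u + v) =
    s ^+ 2 * dot u u + dot v v + 2 * (s * dot u v).
  by rewrite !dotW (dotC v u); ring.
by case: (ger0P (dot u v)) => _; lra.
Qed.

Lemma dot_sqrD d (u v : 'rV[R]_d) :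
  dot (u + v) (u + v) <= 2 * dot u u + 2 * dot v v.
Proof. by have := dot_ge0 (u - v); rewrite !dotW (dotC v u); lra. Qed.

Lemma entry_le_norm d (u : 'rV[R]_d) i : `|u 0 i| <= `|u|.
Proof.
by rewrite [leRHS]/Num.norm /= mx_normrE; apply/bigmax_geP; right; exists (0, i).
Qed.

Lemma norm_le_entries d (u : 'rV[R]_d) (e : R) :
  0 <= e -> (forall i, `|u 0 i| <= e) -> `|u| <= e.
Proof.
move=> e0 ue; rewrite [leLHS]/Num.norm /= mx_normrE.
by apply: bigmax_le => // -[i j] _ /=; rewrite (ord1 i).
Qed.

Lemma sqr_norm_le_dot d (u : 'rV[R]_d) : `|u| ^+ 2 <= dot u u.
Proof.
have [->|] := eqVneq `|u| 0; first by rewrite expr0n dot_ge0.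
move=> /mx_norm_neq0[[i j] /= u_ij].
rewrite [`|u|]u_ij (ord1 i) real_normK ?num_real // dotE (bigD1 j) //= -expr2.
by rewrite lerDl sumr_ge0 // => k _; rewrite -expr2 sqr_ge0.
Qed.

Lemma norm_lt_dot d (u : 'rV[R]_d) (e : R) :
  0 < e -> dot u u < e ^+ 2 -> `|u| < e.
Proof.
move=> e0 ue; have := le_lt_trans (sqr_norm_le_dot u) ue.
by rewrite ltr_pXn2r // nnegrE // ltW.
Qed.

Lemma dot_le_norm d (u v : 'rV[R]_d) : `|dot u v| <= d%:R * (`|u| * `|v|).
Proof.
rewrite dotE (le_trans (ler_norm_sum _ _ _)) //.
apply: (@le_trans _ _ (\sum_(i < d) `|u| * `|v|)).
  by apply: ler_sum => i _; rewrite normrM ler_pM // entry_le_norm.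
by rewrite sumr_const card_ord [leRHS]mulr_natl.
Qed.

Lemma dot_norm_sqr d (u : 'rV[R]_d) : dot u u <= d%:R * `|u| ^+ 2.
Proof.
by have := dot_le_norm u u; rewrite (ger0_norm (dot_ge0 _)) expr2.
Qed.

Lemma quad_form_bounded d (A : 'M[R]_d) :
  exists2 k : R, 0 < k & forall u, `|dot (u *m A) u| <= k * dot u u.
Proof.
pose k := \sum_i \sum_j `|A i j|; exists (k + 1).
  by rewrite ltr_wpDl // sumr_ge0 // => i _; rewrite sumr_ge0.
move=> u; apply: le_trans (_ : k * dot u u <= _); last first.
  by rewrite ler_wpM2r ?dot_ge0 // lerDl.
have -> : dot (u *m A) u = \sum_i \sum_j A j i * (u 0 j * u 0 i).
  rewrite dotE; apply: eq_bigr => i _; rewrite mxE mulr_suml.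
  by apply: eq_bigr => j _; ring.
rewrite /k exchange_big /= mulr_suml (le_trans (ler_norm_sum _ _ _)) //.
apply: ler_sum => i _; rewrite mulr_suml (le_trans (ler_norm_sum _ _ _)) //.
apply: ler_sum => j _; rewrite !normrM ler_wpM2l //.
apply: le_trans (sqr_norm_le_dot u); rewrite expr2.
by rewrite ler_pM // entry_le_norm.
Qed.

End Dot.

(** * Farkas' lemma *)

Section Farkas.
Context {R : realType}.

(** Bartl's induction on the number of inequalities: if the last one cannot be
    dropped, some [x0] violates it while satisfying the others, and subtracting
    multiples of [x0] projects every vector onto the hyperplane of the last
    inequality, where the induction hypothesis applies. *)
Lemma farkas_family d k (a : 'I_k -> 'rV[R]_d) (c : 'rV[R]_d) :
  (forall x, (forall i, dot (a i) x <= 0) -> dot c x <= 0) ->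
  exists2 la : 'I_k -> R, (forall i, 0 <= la i) & c = \sum_i la i *: a i.
Proof.
elim: k a c => [|k IH] a c ac.
  exists (fun=> 0) => //; rewrite big_ord0; apply: dot_eq0.
  by apply: le_anti; rewrite dot_ge0 ac // => -[].
pose a' i := a (widen_ord (leqnSn k) i); pose b := a ord_max.
have split_ord i : (exists j, i = widen_ord (leqnSn k) j) \/ i = ord_max.
  case: (ltnP i k) => [ik|ki]; [left|right].
    by exists (Ordinal ik); apply: val_inj.
  by apply: val_inj; apply/eqP; rewrite eqn_leq ki -ltnS ltn_ord.
have [a'c|] := pselect (forall x, (forall i, dot (a' i) x <= 0) -> dot c x <= 0).
  have [la la0 ->] := IH a' c a'c.
  (* The superfluous last inequality receives the weight 0. *)
  exists (fun i => if insub (val i) is Some j then la j else 0).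
    by move=> i; case: insubP.
  rewrite big_ord_recr /= insubF ?ltnn // scale0r addr0.
  by apply: eq_bigr => i _; rewrite valK.
move=> /existsNP[x /not_implyP[a'x /negP]]; rewrite -ltNge => cx.
have bx : 0 < dot b x.
  rewrite ltNge; apply/negP => bx.
  move: cx; rewrite ltNge ac // => i.
  by have [[j ->]|->] := split_ord i; [exact: a'x|].
(* [P u] is the form [u] composed with the projection along [x] onto the
   hyperplane [b = 0]. *)
pose s := (dot b x)^-1; have s0 : 0 < s by rewrite invr_gt0.
have sb : s * dot b x = 1 by rewrite mulVf // gt_eqF.
pose P u := u - (s * dot u x) *: b.
have PE u y : dot (P u) y = dot u (y - (s * dot b y) *: x).
  by rewrite /P !dotW; ring.
have [y Py|la la0 PcE] := IH (fun i => P (a' i)) (P c).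
  rewrite PE; apply: ac => i; have [[j ->]|->] := split_ord i.
    by rewrite -PE; exact: Py.
  by rewrite !dotW -/b mulrAC sb mul1r subrr.
pose t := s * (dot c x - \sum_i la i * dot (a' i) x).
have t0 : 0 <= t.
  rewrite mulr_ge0 ?(ltW s0) // subr_ge0 (le_trans _ (ltW cx)) //.
  by apply: sumr_le0 => i _; rewrite mulr_ge0_le0.
exists (fun i => if insub (val i) is Some j then la j else t).
  by move=> i; case: insubP.
rewrite big_ord_recr /= insubF ?ltnn // -/b.
have -> : c = P c + (s * dot c x) *: b by rewrite /P subrK.
rewrite PcE; under [X in _ = X + _]eq_bigr do rewrite valK.
have -> : \sum_i la i *: P (a' i) = \sum_i la i *: a' i
    - (s * \sum_i la i * dot (a' i) x) *: b.
  rewrite mulr_sumr scaler_suml -sumrB; apply: eq_bigr => i _.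
  by rewrite /P scalerBr scalerA mulrCA.
rewrite -addrA; congr (_ + _); rewrite -scaleNr -scalerDl /t; congr (_ *: _).
by ring.
Qed.

Lemma farkas_mx d k (M : 'M[R]_(k, d)) (c : 'rV[R]_d) :
  (forall x, (forall i, (x *m M^T) 0 i <= 0) -> dot c x <= 0) ->
  exists2 la : 'rV[R]_k, (forall i, 0 <= la 0 i) & c = la *m M.
Proof.
move=> Mc; have [x rx|la la0 ->] := @farkas_family d k (fun i => row i M) c.
  apply: Mc => i; rewrite -[_ 0 i]dot_delta dot_mulmx trmxK -rowE dotC.
  exact: rx.
exists (\row_i la i) => [i|]; first by rewrite mxE.
by rewrite mulmx_sum_row; apply: eq_bigr => i _; rewrite mxE.
Qed.

(** An equation is a pair of opposite inequalities, so that its multiplier is a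
    difference of two nonnegative numbers and has no sign. *)
Lemma farkas_mixed d p q (A : 'M[R]_(d, p)) (B : 'M[R]_(d, q)) (c : 'rV[R]_d) :
  (forall x : 'rV[R]_d, (forall i, (x *m A) 0 i <= 0) -> x *m B = 0 ->
     dot c x <= 0) ->
  exists (la : 'rV[R]_p) (ka : 'rV[R]_q),
    (forall i, 0 <= la 0 i) /\ c = la *m A^T + ka *m B^T.
Proof.
move=> ABc.
have [x Mx|la la0 ->] := @farkas_mx _ _ (col_mx A^T (col_mx B^T (- B^T))) c.
  have [xA xB xB'] : [/\ forall i, (x *m A) 0 i <= 0,
      forall i, (x *m B) 0 i <= 0 & forall i, 0 <= (x *m B) 0 i].
    move: Mx; rewrite !tr_col_mx !linearN /= !trmxK !mul_mx_row mulmxN => Mx.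
    split=> i.
    - by have := Mx (lshift _ i); rewrite row_mxEl.
    - by have := Mx (rshift _ (lshift _ i)); rewrite row_mxEr row_mxEl.
    - by have := Mx (rshift _ (rshift _ i)); rewrite !row_mxEr mxE oppr_le0.
  apply: ABc => //; apply/rowP => i; rewrite [RHS]mxE; apply: le_anti.
  by rewrite xB xB'.
exists (lsubmx la), (lsubmx (rsubmx la) - rsubmx (rsubmx la)); split.
  by move=> i; rewrite mxE.
rewrite -[in LHS](hsubmxK la) -[in LHS](hsubmxK (rsubmx la)) !mul_row_col.
by rewrite mulmxN mulmxBl.
Qed.

End Farkas.

(** * First and second derivatives *)

Section Calculus.
Context {R : realType}.

Lemma mulmx_continuous a b (A : 'M[R]_(a, b)) :
  continuous (mulmxr A : 'rV[R]_a -> 'rV[R]_b).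
Proof.
apply: bounded_linear_continuous; apply/linear_boundedP.
pose k := a%:R * \sum_j `|(col j A)^T|.
exists k; split=> [|r kr u]; first exact: num_real.
have k0 : 0 <= k by rewrite mulr_ge0 // sumr_ge0.
apply: (@le_trans _ _ (k * `|u|)); last by rewrite ler_wpM2r // ltW.
apply: norm_le_entries => [|j]; first by rewrite mulr_ge0.
have -> : (mulmxr A u) 0 j = dot u (col j A)^T.
  by rewrite /dot trmxK !mxE; apply: eq_bigr => i _; rewrite !mxE.
apply: le_trans (dot_le_norm _ _) _; rewrite /k -!mulrA ler_wpM2l // mulrC.
rewrite ler_wpM2r //.
by rewrite (bigD1 j) //= lerDl sumr_ge0.
Qed.

Lemma diff_mulmx a b (A : 'M[R]_(a, b)) z :
  is_diff z (fun u : 'rV[R]_a => u *m A) (fun u => u *m A).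
Proof.
apply: DiffDef.
  exact: (linear_differentiable z (@mulmx_continuous _ _ A)).
exact: (diff_lin z (@mulmx_continuous _ _ A)).
Qed.

Lemma jacobianE a b (f : 'rV[R]_a -> 'rV[R]_b) z h : h *m 'J f z = 'd f z h.
Proof. by rewrite mul_rV_lin1. Qed.

Lemma jacobian_eq a b (f : 'rV[R]_a -> 'rV[R]_b) z (A : 'M[R]_(a, b)) :
  (forall h, 'd f z h = h *m A) -> 'J f z = A.
Proof. by move=> fA; apply/row_matrixP => i; rewrite !rowE jacobianE fA. Qed.

Lemma dot_grad d (f : 'rV[R]_d -> R) z h : dot (grad f z) h = 'd f z h.
Proof.
rewrite dotE {2}(row_sum_delta h) linear_sum; apply: eq_bigr => j _.
by rewrite linearZ /= /grad mxE mulrC.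
Qed.

Lemma diff_expansion (V W : normedModType R) (f : V -> W) (z : V) :
  differentiable f z -> forall e : R, 0 < e ->
  exists2 r : R, 0 < r &
    forall h, `|h| < r -> `|f (z + h) - f z - 'd f z h| <= e * `|h|.
Proof.
move=> df e e0; have /eqaddoP/(_ e e0)/nbhs_norm0P[r /= r0 fr] := diff_locally df.
exists r => // h hr; have -> : z + h = shift z h by rewrite addrC.
by rewrite -addrA -opprD; exact: fr.
Qed.

Lemma is_derive_line d (f : 'rV[R]_d -> R) z h (s : R) :
  differentiable f (z + s *: h) ->
  is_derive s 1 (fun t : R => f (z + t *: h)) (dot (grad f (z + s *: h)) h).
Proof.
move=> df; pose c (t : R) := z + t *: h.
have dc : is_diff s c (fun t : R => t *: h).
  have -> : (fun t : R => t *: h) = (0 : R -> 'rV[R]_d) + *:%R^~ h.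
    by apply/funext => t; rewrite fctE add0r.
  exact: is_diffD.
have dfc : is_diff s (f \o c) ('d f (c s) \o (fun t : R => t *: h)).
  by apply: is_diff_comp; exact: differentiableP.
have -> : dot (grad f (z + s *: h)) h = 'd (f \o c) s 1.
  by rewrite diff_val /= scale1r dot_grad.
rewrite -deriveE //; exact/derivableP/diff_derivable.
Qed.

Lemma mvt01 (phi dphi : R -> R) :
  (forall s : R, is_derive s 1 phi (dphi s)) ->
  exists2 c, 0 < c < 1 & phi 1 - phi 0 = dphi c.
Proof.
move=> dphiP; have phi_cont : {within `[0, 1], continuous phi}.
  apply: derivable_within_continuous => s _.
  exact: (@ex_derive _ _ _ _ _ _ _ (dphiP s)).
have [c] := MVT ltr01 (fun s _ => dphiP s) phi_cont.
by rewrite in_itv /= subr0 mulr1 => c01 ->; exists c.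
Qed.

Section Hessian.
Variables (d : nat) (f : 'rV[R]_d -> R) (y : 'rV[R]_d).
Hypothesis f_diff : forall z, differentiable f z.
Hypothesis gradf_diff : differentiable (grad f) y.

Let gradE (e : R) : 0 < e -> exists2 r, 0 < r & forall h, `|h| < r ->
  `|grad f (y + h) - grad f y - h *m hess f y| <= e * `|h|.
Proof.
move=> e0; have [r r0 rP] := diff_expansion gradf_diff e0; exists r => // h hr.
by rewrite /hess jacobianE; exact: rP.
Qed.

(** The mean value theorem is applied on the segment from [y] to [y + h] to [f]
    minus its quadratic model, whose derivative is the first-order remainder of
    the gradient at [y]. *)
Lemma taylor2 (e : R) : 0 < e -> exists2 r, 0 < r & forall h, `|h| < r ->
  `|f (y + h) - f y - dot (grad f y) h - 2^-1 * dot (h *m hess f y) h|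
     <= e * dot h h.
Proof.
move=> e0; pose e' := e / (d%:R + 1).
have d1 : 0 < d%:R + 1 :> R by rewrite ltr_wpDl.
have [r r0 rP] := gradE (divr_gt0 e0 d1); exists r => // h hr.
pose phi (s : R) := f (y + s *: h) - s * dot (grad f y) h
  - 2^-1 * s ^+ 2 * dot (h *m hess f y) h.
pose dphi s := dot (grad f (y + s *: h) - grad f y - (s *: h) *m hess f y) h.
have [s|c c01] := @mvt01 phi dphi.
  have Dl (a : R) : is_derive s 1 (fun t : R => t * a) a.
    have -> : (fun t : R => t * a) = (fun t : R => a *: id t).
      by apply/funext => t; rewrite mulrC.
    by apply: is_derive_eq; rewrite /GRing.scale /= mulr1.
  have Dq (a : R) : is_derive s 1 (fun t : R => 2^-1 * t ^+ 2 * a) (s * a).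
    have -> : (fun t : R => 2^-1 * t ^+ 2 * a)
        = (fun t : R => (2^-1 * a) *: (@idfun R ^+ 2) t).
      by apply/funext => t; rewrite /GRing.scale /= exprfctE /=; ring.
    apply: is_derive_eq; rewrite /GRing.scale /= !expr1 -mulr_natr; lra.
  have D := is_derive_line (f_diff (y + s *: h)).
  have -> : dphi s = dot (grad f (y + s *: h)) h - dot (grad f y) h
      - s * dot (h *m hess f y) h.
    by rewrite /dphi -scalemxAl !dotW.
  have DB := is_deriveB D (Dl (dot (grad f y) h)).
  exact: (is_deriveB DB (Dq (dot (h *m hess f y) h))).
rewrite /phi scale1r scale0r addr0 expr1n expr0n /= !mulr1 !mul1r mulr0 !mul0r.
rewrite !subr0 => phiE.
have -> : f (y + h) - f y - dot (grad f y) h - 2^-1 * dot (h *m hess f y) h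
  = dphi c by rewrite -phiE; ring.
have [c0 c1] := andP c01.
have ch : `|c *: h| <= `|h|.
  by rewrite normrZ gtr0_norm // ler_piMl // ltW.
have := rP (c *: h) (le_lt_trans ch hr); rewrite /dphi -/e' => gradc.
apply: le_trans (dot_le_norm _ _) _.
have e'0 : 0 < e' by exact: divr_gt0.
apply: (@le_trans _ _ (d%:R * (e' * `|h| ^+ 2))).
  rewrite ler_wpM2l // expr2 mulrA ler_wpM2r // (le_trans gradc) //.
  by rewrite ler_wpM2l // ltW.
apply: (@le_trans _ _ (e * `|h| ^+ 2)).
  rewrite mulrA ler_wpM2r ?sqr_ge0 // /e' mulrCA ler_piMr ?(ltW e0) //.
  by rewrite ler_pdivrMr // mul1r lerDl.
by rewrite ler_wpM2l ?(ltW e0) // sqr_norm_le_dot.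
Qed.

(** Mean value theorem for [s |-> f (y + t k + s t h) - f (y + s t h)], followed
    by two first-order expansions of the gradient around [y]. *)
Let second_difference (h k : 'rV[R]_d) (e : R) : 0 < e ->
  exists2 r, 0 < r & forall t, 0 < t < r ->
  `|f (y + t *: h + t *: k) - f (y + t *: h) - f (y + t *: k) + f y
     - t ^+ 2 * dot (k *m hess f y) h| <= e * t ^+ 2.
Proof.
move=> e0; pose K := d%:R * ((2 * `|h| + `|k|) * `|h|) + 1.
have K0 : 0 < K by rewrite ltr_wpDl // !mulr_ge0 // addr_ge0 // mulr_ge0.
have [r r0 rP] := gradE (divr_gt0 e0 K0); pose e' := e / K.
have e'0 : 0 < e' by exact: divr_gt0.
have hk0 : 0 < `|h| + `|k| + 1 by rewrite ltr_wpDl // addr_ge0.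
exists (r / (`|h| + `|k| + 1)) => [|t /andP[t0 tr]]; first exact: divr_gt0.
have thk : t * (`|h| + `|k|) < r.
  move: tr; rewrite ltr_pdivlMr // => tr; apply: le_lt_trans tr.
  by rewrite ler_wpM2l ?(ltW t0) // lerDl.
pose phi (s : R) := f (y + t *: k + s *: (t *: h)) - f (y + s *: (t *: h)).
pose G (s : R) := grad f (y + t *: k + s *: (t *: h))
  - grad f (y + s *: (t *: h)).
have [s|c /andP[c0 c1] phiE] := @mvt01 phi (fun s => dot (G s) (t *: h)).
  have D1 := is_derive_line (f_diff (y + t *: k + s *: (t *: h))).
  have D2 := is_derive_line (f_diff (y + s *: (t *: h))).
  have -> : dot (G s) (t *: h) = dot (grad f (y + t *: k + s *: (t *: h))) (t *: h)
      - dot (grad f (y + s *: (t *: h))) (t *: h).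
    by rewrite /G dotDl dotNl.
  exact: (is_deriveB D1 D2).
pose b := c *: (t *: h); pose a := t *: k + b.
pose E x := grad f (y + x) - grad f y - x *m hess f y.
have bn : `|b| <= t * `|h|.
  rewrite /b scalerA normrZ gtr0_norm ?mulr_gt0 // -mulrA.
  by rewrite ler_piMl ?mulr_ge0 ?(ltW t0) // ltW.
have an : `|a| <= t * (`|h| + `|k|).
  rewrite /a (le_trans (ler_normD _ _)) // normrZ gtr0_norm // mulrDr addrC.
  by rewrite lerD2r.
have En : `|E a - E b| <= e' * (t * (2 * `|h| + `|k|)).
  rewrite (le_trans (ler_normB _ _)) //.
  have := rP a (le_lt_trans an thk).
  have bn' : `|b| < r.
    apply: le_lt_trans thk; apply: le_trans bn _.
    by rewrite ler_wpM2l ?(ltW t0) // lerDl.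
  move=> Ea; have Eb := rP b bn'.
  apply: le_trans (lerD Ea Eb) _; rewrite -mulrDr ler_wpM2l ?(ltW e'0) //.
  by apply: le_trans (lerD an bn) _; lra.
have -> : f (y + t *: h + t *: k) - f (y + t *: h) - f (y + t *: k) + f y
     - t ^+ 2 * dot (k *m hess f y) h = dot (E a - E b) (t *: h).
  transitivity (phi 1 - phi 0 - t ^+ 2 * dot (k *m hess f y) h).
    by rewrite /phi !scale1r !scale0r !addr0 [y + t *: k + t *: h]addrAC; ring.
  have sub_errors (ga gb gy p q : 'rV[R]_d) :
      ga - gb = (ga - gy - (p + q)) - (gb - gy - q) + p.
    by apply/rowP => j; rewrite !mxE; ring.
  have GcE : G c = E a - E b + (t *: k) *m hess f y.
    rewrite /E /a mulmxDl [G c](sub_errors _ _ (grad f y) ((t *: k) *m hess f y)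
      (b *m hess f y)).
    by rewrite [y + (_ + b)]addrA.
  rewrite phiE GcE.
  by rewrite dotDl -scalemxAl !dotZr !dotZl; ring.
rewrite (le_trans (dot_le_norm _ _)) // normrZ gtr0_norm //.
apply: (@le_trans _ _ (d%:R * (e' * (t * (2 * `|h| + `|k|)) * (t * `|h|)))).
  by rewrite ler_wpM2l // ler_wpM2r // mulr_ge0 // ltW.
have -> : d%:R * (e' * (t * (2 * `|h| + `|k|)) * (t * `|h|))
   = e' * (K - 1) * t ^+ 2 by rewrite /K; ring.
rewrite ler_wpM2r ?sqr_ge0 // /e' -mulrA ler_piMr ?(ltW e0) //.
by rewrite mulrC ler_pdivrMr // mul1r lerBlDr lerDl.
Qed.

(** Schwarz: both orders of differentiation are limits of the same symmetric
    second difference. *)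
Lemma hess_sym : (hess f y)^T = hess f y.
Proof.
have sym h k : dot (k *m hess f y) h = dot (h *m hess f y) k.
  have [//|neq] := eqVneq (dot (k *m hess f y) h) (dot (h *m hess f y) k).
  set p := dot _ h in neq *; set q := dot _ k in neq *.
  pose e := `|p - q| / 4.
  have e0 : 0 < e by rewrite divr_gt0 // normr_gt0 subr_eq0.
  have [r1 r10 P1] := second_difference h k e0.
  have [r2 r20 P2] := second_difference k h e0.
  pose t := Num.min r1 r2 / 2.
  have m0 : 0 < Num.min r1 r2 by rewrite lt_min r10.
  have t0 : 0 < t by rewrite divr_gt0.
  have tm : t < Num.min r1 r2 by rewrite /t ltr_pdivrMr // ltr_pMr // ltr1n.
  move: tm; rewrite lt_min => /andP[tr1 tr2].
  have := P1 t; rewrite t0 tr1 => /(_ isT); rewrite -/p.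
  have := P2 t; rewrite t0 tr2 => /(_ isT); rewrite -/q.
  rewrite [y + t *: k + t *: h]addrAC.
  move: (f (y + _ + _)) (f (y + t *: h)) (f (y + t *: k)) => A B C.
  have t2 : 0 < t ^+ 2 by rewrite exprn_gt0.
  rewrite !ler_norml => /andP[q1 q2] /andP[p1 p2].
  have : `|t ^+ 2 * (p - q)| <= 2 * e * t ^+ 2.
    by rewrite ler_norml; apply/andP; split; lra.
  rewrite normrM gtr0_norm // mulrC ler_pM2r //.
  have : 0 < `|p - q| by rewrite normr_gt0 subr_eq0.
  by rewrite /e => d0 de; exfalso; lra.
apply/matrixP => i j.
have entry a b : hess f y a b = dot (delta_mx 0 a *m hess f y) (delta_mx 0 b).
  by rewrite dot_delta -rowE [RHS]mxE.
by rewrite mxE (entry j i) (entry i j) sym.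
Qed.

End Hessian.
End Calculus.

(** * Derivatives of the constraint functions *)

Section ConstraintCalculus.
Context {R : realType}.

Lemma diff_coord a b (f : 'rV[R]_a -> 'rV[R]_b) i z h :
  differentiable f z -> 'd (fun z => f z 0 i) z h = 'd f z h 0 i.
Proof.
move=> df; have @c : {linear 'rV[R]_b -> R}.
  by exists (fun N : 'rV[R]_b => N 0 i); do 2![eexists]; do ?[constructor];
     rewrite ?mxE// => ? *; rewrite ?mxE//; move=> ?; rewrite !mxE.
have cc : continuous c by exact: coord_continuous.
have dc : differentiable c (f z) by exact: linear_differentiable.
rewrite -[LHS]/('d (c \o f) z h) (diff_comp df dc) /=.
by rewrite (diff_lin _ cc).
Qed.

Lemma diff_comp_mulmx a b c (f : 'rV[R]_a -> 'rV[R]_b) (A : 'M[R]_(b, c)) z h :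
  differentiable f z -> 'd (fun z => f z *m A) z h = 'd f z h *m A.
Proof.
move=> df; have [dA dAE] := diff_mulmx A (f z).
by rewrite -[LHS]/('d ((fun u => u *m A) \o f) z h) (diff_comp df dA) /= dAE.
Qed.

Context {m l : nat} (g : 'rV[R]_m -> 'rV[R]_l).
Hypothesis g_C2 : C2 g.

Lemma C2_differentiable z : differentiable g z.
Proof. by have [[]] := g_C2. Qed.

Lemma constraint_differentiable i z : differentiable (fun z => g z 0 i) z.
Proof.
apply: (@differentiable_comp _ _ _ _ g (fun w : 'rV[R]_l => w 0 i)).
  exact: C2_differentiable.
exact: differentiable_coord.
Qed.

Lemma grad_g_differentiable i z : differentiable (grad_g g i) z.
Proof. by have [_ /(_ i)[]] := g_C2. Qed.

Lemma grad_gE i z h : dot (grad_g g i z) h = 'd g z h 0 i.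
Proof. by rewrite dot_grad diff_coord //; exact: C2_differentiable. Qed.

Lemma mul_tr_jacobian lam z :
  lam *m ('J g z)^T = \sum_i lam 0 i *: grad_g g i z.
Proof.
apply/rowP => j; rewrite -[LHS]dot_delta dot_mulmx trmxK jacobianE summxE dotE.
apply: eq_bigr => i _; rewrite mxE -grad_gE dot_delta //.
Qed.

(** The Hessian of the Lagrangian is the Jacobian of this gradient, so the
    formula is needed at every point before it can be differentiated again. *)
Lemma grad_lag lam z :
  grad (fun z => dot lam (g z)) z = \sum_i lam 0 i *: grad_g g i z.
Proof.
have lagE : (fun z => dot lam (g z)) = fun z => (g z *m lam^T) 0 0.
  by apply/funext => u; rewrite dotC.
have dg := @C2_differentiable z.
have dl : differentiable (fun z => g z *m lam^T) z.
  have [dA _] := diff_mulmx lam^T (g z).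
  exact: (differentiable_comp dg dA).
apply/rowP => j; rewrite mxE lagE diff_coord // diff_comp_mulmx // summxE.
rewrite -[LHS]/(dot _ _) dotC dotE; apply: eq_bigr => i _.
by rewrite [RHS]mxE -grad_gE dot_delta.
Qed.

Lemma hess_lagE lam z :
  hess_lag g lam z = \sum_i lam 0 i *: hess (fun z => g z 0 i) z.
Proof.
have gradE : grad (fun z => dot lam (g z)) = \sum_i (lam 0 i *: grad_g g i).
  by apply/funext => u; rewrite grad_lag fct_sumE.
apply: jacobian_eq => h; rewrite gradE mulmx_sumr.
have dZ i : differentiable (lam 0 i *: grad_g g i) z.
  exact/differentiableZ/grad_g_differentiable.
rewrite -deriveE; last exact: differentiable_sum.
rewrite derive_sum => [|i]; last exact: diff_derivable.
apply: eq_bigr => i _; rewrite deriveE // diffZ; last exact: grad_g_differentiable.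
by rewrite -scalemxAr jacobianE.
Qed.

Lemma hess_lag_sym lam z : (hess_lag g lam z)^T = hess_lag g lam z.
Proof.
rewrite hess_lagE linear_sum; apply: eq_bigr => i _; rewrite linearZ /= hess_sym //.
  exact: constraint_differentiable.
exact: grad_g_differentiable.
Qed.

(** The remainder is measured by [dot h h] rather than by the square of the norm,
    which is the supremum norm. *)
Definition taylor_at (y : 'rV[R]_m) (e : R) (h : 'rV[R]_m) : Prop :=
  forall i, `|g (y + h) 0 i - g y 0 i - dot (grad_g g i y) h
              - 2^-1 * dot (h *m hess (fun z => g z 0 i) y) h| <= e * dot h h.

Lemma constraint_taylor y (e : R) : 0 < e ->
  exists2 r, 0 < r & forall h, `|h| < r -> taylor_at y e h.
Proof.
move=> e0.
have taylor_i i : \forall h \near (0 : 'rV[R]_m),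
    `|g (y + h) 0 i - g y 0 i - dot (grad_g g i y) h
      - 2^-1 * dot (h *m hess (fun z => g z 0 i) y) h| <= e * dot h h.
  apply/nbhs_norm0P.
  have [||r r0 rP] := @taylor2 _ _ (fun z => g z 0 i) y _ _ e e0.
  - exact: constraint_differentiable.
  - exact: grad_g_differentiable.
  - by exists r.
have : \forall h \near (0 : 'rV[R]_m), taylor_at y e h.
  exact: filter_forall taylor_i.
by move=> /nbhs_norm0P[r /= r0 rP]; exists r.
Qed.

Lemma Gamma_closed : closed (Gamma g).
Proof.
have -> : Gamma g = \bigcap_(i in [set: 'I_l]) [set y | g y 0 i <= 0].
  by apply/seteqP; split=> y /= yP i; [move=> _|]; apply: yP.
apply: closed_bigI => i _.
apply: (@preimage_closed _ _ (fun y => g y 0 i) [set x : R | x <= 0]).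
  by move=> y _; apply/differentiable_continuous/constraint_differentiable.
exact: closed_le.
Qed.

End ConstraintCalculus.

(** * Tangent and normal cones *)

Section Cones.
Context {R : realType} {d : nat}.
Implicit Types (Theta : set 'rV[R]_d) (z u : 'rV[R]_d).

Lemma tangent_cone_approx Theta z u :
  (forall e : R, 0 < e -> exists t u', [/\ 0 < t < e, `|u - u'| < e
     & Theta (z + t *: u')]) -> tangent_cone Theta z u.
Proof.
move=> approx; have inv0 k : 0 < k.+1%:R^-1 :> R by rewrite invr_gt0.
have /choice[tu tuP] k : exists p : R * 'rV[R]_d, [/\ 0 < p.1 < k.+1%:R^-1,
    `|u - p.2| < k.+1%:R^-1 & Theta (z + p.1 *: p.2)].
  by have [t [u' tu']] := approx _ (inv0 k); exists (t, u').
exists (fun k => (tu k).1), (fun k => (tu k).2); split.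
- by move=> k; have [/andP[]] := tuP k.
- apply/cvgrPdist_lt => e e0; near=> k.
  have [/andP[t0 tk] _ _] := tuP k.
  rewrite sub0r normrN gtr0_norm // (lt_trans tk) //.
  by near: k; exact: near_infty_natSinv_lt (PosNum e0).
- apply/cvgrPdist_lt => e e0; near=> k.
  have [_ uk _] := tuP k; rewrite (lt_trans uk) //.
  by near: k; exact: near_infty_natSinv_lt (PosNum e0).
- by move=> k; have [] := tuP k.
Unshelve. all: by end_near. Qed.

Lemma tangent_cone_feasible_ray Theta z u (r : R) : 0 < r ->
  (forall t, 0 < t < r -> Theta (z + t *: u)) -> tangent_cone Theta z u.
Proof.
move=> r0 rP; apply: tangent_cone_approx => e e0.
have m0 : 0 < Num.min e r by rewrite lt_min e0.
have : Num.min e r / 2 < Num.min e r by rewrite ltr_pdivrMr // ltr_pMr // ltr1n.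
rewrite lt_min => /andP[te tr]; exists (Num.min e r / 2), u.
have t0 : 0 < Num.min e r / 2 by rewrite divr_gt0.
by rewrite t0 te subrr normr0; split=> //; apply: rP; rewrite t0.
Qed.

Lemma tangent_cone0 Theta z : Theta z -> tangent_cone Theta z 0.
Proof.
move=> zT; apply: (@tangent_cone_feasible_ray _ _ _ 1) => // t _.
by rewrite scaler0 addr0.
Qed.

Lemma tangent_coneZ Theta z u (a : R) : 0 < a ->
  tangent_cone Theta z u -> tangent_cone Theta z (a *: u).
Proof.
move=> a0 [t [u_ [t0 tc uc uT]]].
exists (fun k => a^-1 * t k), (fun k => a *: u_ k); split.
- by move=> k; rewrite mulr_gt0 // invr_gt0.
- by rewrite -(mulr0 a^-1); exact: cvgMl_tmp.
- exact: cvgZl_tmp.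
- by move=> k; rewrite scalerA mulrAC mulVf ?mul1r // gt_eqF.
Qed.

(** Proximal normals are regular normals: along a feasible sequence
    [z + t_k u_k] the quadratic term is of order [t_k ^ 2]. *)
Lemma proximal_normal Theta z (p : 'rV[R]_d) (s r : R) : 0 < r -> Theta z ->
  (forall w, Theta w -> `|w - z| < r ->
     dot p (w - z) <= s * dot (w - z) (w - z)) ->
  regular_normal_cone Theta z p.
Proof.
move=> r0 zT prox; split=> // u [t [u_ [t0 tc uc uT]]].
apply/ler_addgt0Pr => e e0; rewrite add0r.
have nu0 : 0 < `|u| + 1 by rewrite ltr_wpDl.
pose K1 := d%:R * `|p| + 1; pose K2 := `|s| * (d%:R * (`|u| + 1) ^+ 2) + 1.
have K10 : 0 < K1 by rewrite ltr_wpDl // mulr_ge0.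
have K20 : 0 < K2.
  by rewrite ltr_wpDl // mulr_ge0 // mulr_ge0 // exprn_ge0 // ltW.
near \oo => k.
have tk0 := t0 k.
have tk1 : t k < r / (`|u| + 1).
  rewrite -[t k]gtr0_norm // -[t k]subr0 distrC.
  by near: k; apply: (cvgrPdist_lt _ _).1 => //; exact: divr_gt0.
have tk2 : t k < e / 2 / K2.
  rewrite -[t k]gtr0_norm // -[t k]subr0 distrC.
  by near: k; apply: (cvgrPdist_lt _ _).1 => //; rewrite !divr_gt0.
have uk1 : `|u - u_ k| < 1 by near: k; apply: (cvgrPdist_lt _ _).1.
have uk2 : `|u - u_ k| < e / 2 / K1.
  by near: k; apply: (cvgrPdist_lt _ _).1 => //; rewrite !divr_gt0.
have ukn : `|u_ k| < `|u| + 1.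
  rewrite -[u_ k](subKr u) (le_lt_trans (ler_normB _ _)) //.
  by rewrite ltrD2l.
have := prox _ (uT k); rewrite addrAC subrr add0r normrZ gtr0_norm //.
have tkr : t k * `|u_ k| < r.
  apply: le_lt_trans (_ : t k * (`|u| + 1) < r).
    by rewrite ler_wpM2l ?ltW.
  by rewrite -ltr_pdivlMr.
move=> /(_ tkr); rewrite !dotZr dotZl mulrCA ler_pM2l // => puk.
have duk : dot (u_ k) (u_ k) <= d%:R * (`|u| + 1) ^+ 2.
  apply: le_trans (dot_norm_sqr _) _; rewrite ler_wpM2l //.
  by rewrite lerXn2r ?nnegrE // ltW.
have -> : dot p u = dot p (u_ k) + dot p (u - u_ k).
  by rewrite -dotDr addrC subrK.
have pu1 : dot p (u_ k) <= e / 2.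
  apply: le_trans puk _; apply: le_trans (_ : t k * K2 <= _); last first.
    by rewrite -ler_pdivlMr // ltW.
  rewrite mulrCA ler_wpM2l ?(ltW tk0) // (le_trans (ler_norm _)) // normrM.
  rewrite (ger0_norm (dot_ge0 _)) /K2 ler_wpDr // ler_wpM2l //.
have pu2 : dot p (u - u_ k) <= e / 2.
  rewrite (le_trans (ler_norm _)) // (le_trans (dot_le_norm _ _)) // mulrA.
  apply: le_trans (_ : K1 * `|u - u_ k| <= _).
    by rewrite ler_wpM2r // /K1 lerDl.
  by rewrite mulrC -ler_pdivlMr // ltW.
by rewrite [e]splitr lerD.
Unshelve. all: by end_near. Qed.

End Cones.

(** * Multipliers and linear programming duality *)

Section Duality.
Context {R : realType}.

(** Strong duality for the maximization of a linear form over the multipliers.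
    The dual system is homogenized by an extra variable [s]: if it had no
    solution with [s > 0], Farkas' lemma would give weights [mu] and [tau], and
    the feasible vector [(lam + mu) / (1 + tau)] would improve on the optimal
    [lam] by [1 / (1 + tau)]. *)
Lemma lp_duality m l (a : 'I_l -> 'rV[R]_m) (b : 'I_l -> R) (S : set 'I_l)
    (ys : 'rV[R]_m) (lam : 'rV[R]_l) :
  let feas (la : 'rV[R]_l) := [/\ forall i, 0 <= la 0 i,
      forall i, ~ S i -> la 0 i = 0 & \sum_i la 0 i *: a i = ys] in
  feas lam ->
  (forall la, feas la -> \sum_i la 0 i * b i <= \sum_i lam 0 i * b i) ->
  exists2 z, forall i, S i -> dot (a i) z + b i <= 0
           & - dot ys z <= \sum_i lam 0 i * b i.
Proof.
move=> feas [lam0 lamS lamE] lam_max; set c := \sum_i _.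
(* Multiplying by [chi] trivializes the inequalities outside of [S]. *)
pose chi i : R := (i \in S)%:R.
have chi0 i : 0 <= chi i by exact: ler0n.
pose A1 : 'M[R]_(l, m) := \matrix_i (chi i *: a i).
pose A2 : 'cV[R]_l := \col_i (chi i * b i).
pose M := col_mx (row_mx A1 A2) (row_mx (- ys) (- c)%:M).
have ineqE (z : 'rV[R]_m) (s : 'rV[R]_1) i :
    (row_mx z s *m M^T) 0 (lshift 1 i) = chi i * (dot (a i) z + s 0 0 * b i).
  rewrite tr_col_mx mul_mx_row row_mxEl tr_row_mx mul_row_col mxE mulrDr.
  congr (_ + _); last by rewrite mxE big_ord1 [A2^T _ _]mxE [A2 _ _]mxE mulrCA.
  rewrite -dotZl dotE mxE; apply: eq_bigr => j _.
  by rewrite !mxE mulrC.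
have objE (z : 'rV[R]_m) (s : 'rV[R]_1) :
    (row_mx z s *m M^T) 0 (rshift l 0) = - dot ys z - s 0 0 * c.
  rewrite tr_col_mx mul_mx_row row_mxEr tr_row_mx mul_row_col mxE.
  congr (_ + _); first by rewrite linearN /= mulmxN mxE dotC.
  by rewrite mxE big_ord1 tr_scalar_mx mxE eqxx mulr1n mulrN.
have [[x [xM x1]]|noz] := pselect (exists x : 'rV[R]_(m + 1),
    (forall i, (x *m M^T) 0 i <= 0) /\ 0 < rsubmx x 0 0).
  move: xM; rewrite -[x]hsubmxK; set z := lsubmx x; set s := rsubmx x => xM.
  have s0 : 0 < s 0 0 by move: x1.
  exists ((s 0 0)^-1 *: z) => [i Si|].
    have := xM (lshift 1 i); rewrite ineqE /chi mem_set // mul1r => zi.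
    rewrite dotZr -(ler_pM2l s0) mulr0 mulrDr mulrA mulfV ?gt_eqF //.
    by rewrite mul1r.
  have := xM (rshift l 0); rewrite objE => zo.
  rewrite dotZr -(ler_pM2l s0) mulrN mulrA mulfV ?gt_eqF // mul1r.
  by rewrite -subr_le0.
have [x xM|la la0 laE] := @farkas_mx _ _ _ M (row_mx 0 1).
  rewrite -[x]hsubmxK dot_row_mx dot0l add0r leNgt; apply/negP => x1.
  apply: noz; exists x; split=> //; move: x1.
  by rewrite dotE big_ord1 mxE mul1r.
pose tau := la 0 (rshift l 0); pose mu := lsubmx la.
have tau0 : 0 <= tau by exact: la0.
have mu0 i : 0 <= mu 0 i by rewrite mxE.
have [muA muB] : \sum_i (chi i * mu 0 i) *: a i = tau *: ys /\
    \sum_i (chi i * mu 0 i) * b i = 1 + tau * c.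
  move: laE; rewrite -[la]hsubmxK -/mu mul_row_col !mul_mx_row.
  rewrite add_row_mx => /eq_row_mx[e1 e2]; split.
    have -> : \sum_i (chi i * mu 0 i) *: a i = mu *m A1.
      rewrite mulmx_sum_row; apply: eq_bigr => i _.
      by rewrite rowK scalerA mulrC.
    move/esym/eqP: e1; rewrite addr_eq0 => /eqP ->.
    rewrite mulmxN opprK; apply/rowP => j.
    by rewrite !mxE big_ord1 mxE.
  have muA2 : (mu *m A2) 0 0 = \sum_i chi i * mu 0 i * b i.
    by rewrite mxE; apply: eq_bigr => i _; rewrite [A2 _ _]mxE; ring.
  have lac : (rsubmx la *m (- c)%:M) 0 0 = - (tau * c).
    by rewrite mul_mx_scalar mxE [rsubmx _ _ _]mxE -/tau mulNr mulrC.
  have := congr1 (fun X : 'M[R]_1 => X 0 0) e2.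
  by rewrite [LHS]mxE eqxx mulr1n [RHS]mxE muA2 lac => h; lra.
clearbody mu.
have t1 : 0 < 1 + tau by rewrite ltr_pwDl.
pose la' := \row_i ((1 + tau)^-1 * (lam 0 i + chi i * mu 0 i)).
have la'_feas : feas la'.
  split=> [i|i Si|].
  - by rewrite mxE mulr_ge0 ?invr_ge0 ?(ltW t1) // addr_ge0 // mulr_ge0.
  - by rewrite mxE lamS // /chi memNset // mul0r addr0 mulr0.
  - under eq_bigr do rewrite mxE -scalerA scalerDl.
    rewrite -scaler_sumr big_split /= lamE muA.
    have -> : ys + tau *: ys = (1 + tau) *: ys by rewrite scalerDl scale1r.
    by rewrite scalerA mulVf ?scale1r // gt_eqF.
have := lam_max _ la'_feas.
under eq_bigr do rewrite mxE -mulrA mulrDl.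
rewrite -mulr_sumr big_split /= muB -/c mulrC ler_pdivrMr //.
by rewrite mulrDr mulr1 lerD2l mulrC gerDr ler10.
Qed.

End Duality.

Section Multipliers.
Context {R : realType} {m l : nat} (g : 'rV[R]_m -> 'rV[R]_l).
Hypothesis g_C2 : C2 g.
Implicit Types (y ys v : 'rV[R]_m) (lam : 'rV[R]_l).

(** The coordinate directions are tangent: all the decreasing ones, and also the
    increasing ones at the negative coordinates of [x]. *)
Lemma normal_nonpos_orthantP (x lam : 'rV[R]_l) :
  regular_normal_cone nonpos_orthant x lam <->
  [/\ forall i, x 0 i <= 0, forall i, 0 <= lam 0 i
    & forall i, lam 0 i * x 0 i = 0].
Proof.
split=> [[x0 lamN]|[x0 lam0 compl]]; last first.
  apply: (@proximal_normal _ _ _ _ _ 0 1) => // w w0 _.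
  rewrite mul0r dotE; apply: sumr_le0 => i _.
  by rewrite !mxE mulrBr compl subr0 mulr_ge0_le0 //; exact: w0.
have lam0 i : 0 <= lam 0 i.
  rewrite -oppr_le0 -dot_delta -dotNr; apply: lamN.
  apply: (@tangent_cone_feasible_ray _ _ _ _ _ 1) => // t /andP[t0 _] j.
  rewrite !mxE eqxx /= mulrN subr_le0 (le_trans (x0 j)) //.
  by rewrite mulr_ge0 ?(ltW t0).
split=> // i; have := x0 i; rewrite le_eqVlt => /orP[/eqP ->|xi]; first exact: mulr0.
have : lam 0 i <= 0.
  rewrite -dot_delta; apply: lamN.
  apply: (@tangent_cone_feasible_ray _ _ _ _ _ (- x 0 i)).
    by rewrite oppr_gt0.
  move=> t /andP[t0 tx] j; rewrite !mxE eqxx /=.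
  have [->|] := eqVneq j i; last by rewrite mulr0 addr0.
  by rewrite mulr1; lra.
by move=> li; rewrite (_ : lam 0 i = 0) ?mul0r //; apply: le_anti; rewrite li lam0.
Qed.

Lemma multipliersP y ys lam : multipliers g y ys lam <->
  [/\ Gamma g y, forall i, 0 <= lam 0 i, forall i, lam 0 i * g y 0 i = 0
    & \sum_i lam 0 i *: grad_g g i y = ys].
Proof.
rewrite /multipliers /= mul_tr_jacobian //; split.
  by move=> [/normal_nonpos_orthantP[]].
by move=> [? ? ? ?]; split=> //; apply/normal_nonpos_orthantP.
Qed.

Lemma multiplier_inactive y ys lam i :
  multipliers g y ys lam -> ~ active g y i -> lam 0 i = 0.
Proof.
move=> /multipliersP[_ _ /(_ i) /eqP + _] gi; rewrite mulf_eq0.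
by case/orP => /eqP // /gi.
Qed.

Lemma Iplus_active y ys i : Iplus g y ys i -> active g y i.
Proof.
move=> [lam lamM /= li]; apply: contrapT => /(multiplier_inactive lamM) li0.
by move: li; rewrite li0 ltxx.
Qed.

(** A directional multiplier solves a linear program. Its dual solution [z] is
    the acceleration that makes the arc [y + t v + t^2 z / 2] feasible up to
    o(t^2), and equality of the optimal values makes the linear form [ys] as large
    along this arc as feasibility permits. *)
Lemma second_order_correction y ys v lam : dir_multipliers g y ys v lam ->
  exists2 z, forall i, active g y i ->
      dot (grad_g g i y) z + dot (v *m hess (fun z => g z 0 i) y) v <= 0
    & - dot ys z <= dot (v *m hess_lag g lam y) v.
Proof.
move=> [lamM lam_max]; have [yG lam0 compl lamE] := (multipliersP _ _ _).1 lamM.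
have quadE la : dot (v *m hess_lag g la y) v
    = \sum_i la 0 i * dot (v *m hess (fun z => g z 0 i) y) v.
  rewrite hess_lagE // mulmx_sumr dot_suml; apply: eq_bigr => i _.
  by rewrite -scalemxAr dotZl.
have [||z zA zB] := @lp_duality _ _ _ (fun i => grad_g g i y)
  (fun i => dot (v *m hess (fun z => g z 0 i) y) v) (active g y) ys lam.
- split; [exact: lam0| |exact: lamE] => i; exact: multiplier_inactive lamM.
- move=> la [la0 laS laE]; have laM : multipliers g y ys la.
    apply/multipliersP; split; [exact: yG|exact: la0| |exact: laE] => i.
    by have [->|/laS ->] := pselect (active g y i); rewrite ?mulr0 ?mul0r.
  by have := lam_max la laM; rewrite [X in X <= _ -> _]quadE [X in _ <= X -> _]quadE.
by exists z => //; rewrite [leRHS]quadE.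
Qed.

End Multipliers.

(** * Feasible arcs *)

Section Arcs.
Context {R : realType} {m l : nat} (g : 'rV[R]_m -> 'rV[R]_l).
Hypothesis g_C2 : C2 g.
Implicit Types (y ys v d : 'rV[R]_m) (lam : 'rV[R]_l).

Lemma near0rightP (P : R -> Prop) :
  (\forall t \near (0 : R)^'+, P t) <->
  exists2 r, 0 < r & forall t, 0 < t < r -> P t.
Proof.
split=> [|[r r0 rP]].
  move=> /nbhs_normP[r /= r0 rP]; exists r => // t /andP[t0 tr].
  by apply: rP => //=; rewrite sub0r normrN gtr0_norm.
near=> t; apply: rP; apply/andP; split; first by near: t; exact: nbhs_right_gt.
by near: t; exact: nbhs_right_lt.
Unshelve. all: by end_near. Qed.

Lemma near0_mul_lt (K e : R) : 0 < e -> \forall t \near (0 : R)^'+, t * K < e.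
Proof.
move=> e0; apply/near0rightP; have K1 : 0 < `|K| + 1 by rewrite ltr_wpDl.
exists (e / (`|K| + 1)) => [|t /andP[t0 te]]; first exact: divr_gt0.
apply: le_lt_trans (_ : t * (`|K| + 1) < e); last by rewrite -ltr_pdivlMr.
by rewrite ler_wpM2l ?(ltW t0) // (le_trans (ler_norm K)) // lerDl.
Qed.

Lemma near0_arc_small v d (r : R) : 0 < r ->
  \forall t \near (0 : R)^'+, `|t *: v + t ^+ 2 *: d| < r.
Proof.
move=> r0; near=> t.
have t0 : 0 < t by near: t; exact: nbhs_right_gt.
have t1 : t < 1 by near: t; exact: nbhs_right_lt.
have tr : t * (`|v| + `|d|) < r by near: t; exact: near0_mul_lt.
apply: le_lt_trans tr; rewrite (le_trans (ler_normD _ _)) // !normrZ.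
rewrite (gtr0_norm t0) mulrDr lerD2l -mulrA ler_wpM2l ?(ltW t0) //.
by rewrite ler_piMl // ltW.
Unshelve. all: by end_near. Qed.

(** Each active constraint decreases at first order, or is stationary at first
    order and decreases at second order. *)
Lemma feasible_arc y v d : Gamma g y ->
  (forall i, active g y i -> dot (grad_g g i y) v <= 0) ->
  (forall i, active g y i -> dot (grad_g g i y) v = 0 ->
     dot (grad_g g i y) d
       + 2^-1 * dot (v *m hess (fun z => g z 0 i) y) v < 0) ->
  \forall t \near (0 : R)^'+, Gamma g (y + (t *: v + t ^+ 2 *: d)).
Proof.
move=> yG v1 v2.
suff gi i : \forall t \near (0 : R)^'+, g (y + (t *: v + t ^+ 2 *: d)) 0 i <= 0.
  exact: filter_forall gi.
move: (v1 i) (v2 i); set a := grad_g g i y.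
set H := hess (fun z => g z 0 i) y => {}v1 {}v2.
have [k k0 kP] := quad_form_bounded H.
pose N : R := 2 * dot v v + 2 * dot d d.
have N0 : 0 <= N by rewrite addr_ge0 // mulr_ge0 // dot_ge0.
pose X : R := `|dot a d| + k * N + N.
have kN0 : 0 <= k * N by rewrite mulr_ge0 // ltW.
have X0 : 0 <= X := addr_ge0 (addr_ge0 (normr_ge0 _) kN0) N0.
pose B : R := `|dot (v *m H) d| + `|dot (d *m H) v| + `|dot (d *m H) d|.
pose arc_bound (e t : R) := exists p : R, [/\ g (y + (t *: v + t ^+ 2 *: d)) 0 i <=
      g y 0 i + t * dot a v + t ^+ 2 * (dot a d + 2^-1 * p + e * N),
      p <= k * N & p <= dot (v *m H) v + t * B].
have taylor_arc (e : R) : 0 < e -> \forall t \near (0 : R)^'+, arc_bound e t.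
  move=> e0; have [r r0 rP] := constraint_taylor g_C2 y e0; near=> t.
  have t0 : 0 < t by near: t; exact: nbhs_right_gt.
  have t1 : t < 1 by near: t; exact: nbhs_right_lt.
  have hr : `|t *: v + t ^+ 2 *: d| < r by near: t; exact: near0_arc_small.
  have hE : t *: v + t ^+ 2 *: d = t *: (v + t *: d).
    by rewrite scalerDr scalerA -expr2.
  have := rP _ hr i; rewrite /arc_bound hE -/a -/H; set w := v + t *: d.
  have wN : dot w w <= N.
    rewrite (le_trans (dot_sqrD _ _)) // lerD2l !dotW ler_wpM2l // mulrA.
    by rewrite ler_piMl ?dot_ge0 // -expr2 expr_le1 // ltW.
  rewrite -scalemxAl !dotZl !dotZr ler_norml => /andP[_ up].
  exists (dot (w *m H) w); split.
  - have := ler_wpM2l (ltW e0) (ler_wpM2l (sqr_ge0 t) wN).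
    have awE : dot a w = dot a v + t * dot a d by rewrite /w dotDr dotZr.
    move: up; rewrite awE; move: (dot (w *m H) w) (dot w w) => p3 p4.
    move: (g (y + _) 0 i) (g y 0 i) => p1 p2 up up2; lra.
  - rewrite (le_trans (ler_norm _)) // (le_trans (kP w)) //.
    by rewrite ler_wpM2l ?(ltW k0).
  - rewrite /B /w mulmxDl -scalemxAl !dotW.
    have n1 := ler_norm (dot (v *m H) d); have n2 := ler_norm (dot (d *m H) v).
    have n3 := ler_norm (dot (d *m H) d).
    have q1 := ler_wpM2l (ltW t0) n1; have q2 := ler_wpM2l (ltW t0) n2.
    have q3 : t * (t * dot (d *m H) d) <= t * `|dot (d *m H) d|.
      rewrite ler_wpM2l ?(ltW t0) // (le_trans (ler_norm _)) // normrM.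
      by rewrite ler_piMl // gtr0_norm // ltW.
    lra.
have quad_le (t p : R) : 0 < t < 1 -> p <= k * N ->
    t ^+ 2 * (dot a d + 2^-1 * p + 1 * N) <= t ^+ 2 * X.
  move=> _ pN; rewrite ler_wpM2l ?sqr_ge0 // /X mul1r.
  have := ler_norm (dot a d); lra.
have [gy0|gy0] := pselect (active g y i); last first.
  have gyN : 0 < - g y 0 i by rewrite oppr_gt0 lt_neqAle yG andbT; apply/eqP.
  near=> t.
  have t0 : 0 < t by near: t; exact: nbhs_right_gt.
  have t1 : t < 1 by near: t; exact: nbhs_right_lt.
  have tK : t * (`|dot a v| + X) < - g y 0 i by near: t; exact: near0_mul_lt.
  have [p [up pN _]] : arc_bound 1 t by near: t; exact: taylor_arc.
  have t01 : 0 < t < 1 by rewrite t0.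
  have q1 := ler_wpM2l (ltW t0) (ler_norm (dot a v)).
  have q2 := quad_le _ _ t01 pN.
  have q3 : t ^+ 2 * X <= t * X by rewrite ler_wpM2r // expr2 ler_piMl // ltW.
  by apply: le_trans up _; rewrite mulrDr in tK; lra.
have {}v1 := v1 gy0; have {}v2 := v2 gy0.
have gy00 : g y 0 i = 0 by [].
have [av0|/eqP av0] := eqVneq (dot a v) 0; last first.
  have avN : 0 < - dot a v by rewrite oppr_gt0 lt_neqAle v1 andbT; apply/eqP.
  near=> t.
  have t0 : 0 < t by near: t; exact: nbhs_right_gt.
  have t1 : t < 1 by near: t; exact: nbhs_right_lt.
  have tK : t * X < - dot a v by near: t; exact: near0_mul_lt.
  have [p [up pN _]] : arc_bound 1 t by near: t; exact: taylor_arc.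
  have t01 : 0 < t < 1 by rewrite t0.
  have q2 := quad_le _ _ t01 pN.
  have q3 := ler_wpM2l (ltW t0) (ltW tK).
  by apply: le_trans up _; rewrite expr2 -mulrA in q2; lra.
pose c : R := - (dot a d + 2^-1 * dot (v *m H) v).
have c0 : 0 < c by rewrite oppr_gt0 v2.
pose e : R := c / (4 * (N + 1)).
have N1 : 0 < 4 * (N + 1) by rewrite mulr_gt0 // ltr_wpDl.
have e0 : 0 < e by exact: divr_gt0.
have eN : e * N <= c / 4.
  by rewrite /e mulrAC ler_pdivrMr //; nra.
near=> t.
have t0 : 0 < t by near: t; exact: nbhs_right_gt.
have tB : t * B < c by near: t; exact: near0_mul_lt.
have [p [up _ pB]] : arc_bound e t by near: t; exact: taylor_arc.
apply: le_trans up _; rewrite gy00 av0 mulr0 !add0r.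
rewrite mulr_ge0_le0 ?sqr_ge0 //.
have cE : c = - (dot a d + 2^-1 * dot (v *m H) v) by [].
clearbody c; lra.
Unshelve. all: by end_near. Qed.
End Arcs.

(** * Tangents to the graph of the normal cone map *)

Section Minimization.
Context {R : realType} {d : nat}.
Implicit Types (Theta : set 'rV[R]_d) (y c p w : 'rV[R]_d).

(** Up to a constant, [s / 2] times the squared distance to [c + s^-1 *: p]. *)
Definition prox_objective p c (s : R) w : R :=
  - dot p (w - c) + s / 2 * dot (w - c) (w - c).

Lemma prox_objective_continuous p c (s : R) : continuous (prox_objective p c s).
Proof.
pose F (i : 'I_d) (u : 'rV[R]_d) : R :=
  (s / 2 * (u 0 i - c 0 i) - p 0 i) * (u 0 i - c 0 i).
have -> : prox_objective p c s = \sum_i F i.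
  apply/funext => u; rewrite /prox_objective fct_sumE !dotE mulr_sumr -sumrN.
  by rewrite -big_split; apply: eq_bigr => i _; rewrite /F !mxE /=; ring.
move=> w; apply: differentiable_continuous; apply: differentiable_sum => i.
have dc : differentiable (fun u : 'rV[R]_d => u 0 i - c 0 i) w.
  apply: differentiableB; last exact: differentiable_cst.
  exact: differentiable_coord.
apply: differentiableM => //; apply: differentiableB.
  exact: (@differentiableZ _ _ _ _ (s / 2) _ dc).
exact: differentiable_cst.
Qed.

(** A source of normals to a nonconvex set: projecting a point onto [Theta]. The
    ball gives compactness, and is harmless once the minimizer is known to be
    interior to it. *)
Lemma prox_minimizer Theta y p c w0 (s r : R) : closed Theta -> 0 < r ->
  Theta w0 -> `|w0 - y| <= r ->
  exists w, [/\ Theta w, `|w - y| <= r,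
    prox_objective p c s w <= prox_objective p c s w0
  & `|w - y| < r -> regular_normal_cone Theta w (p - s *: (w - c))].
Proof.
move=> Tc r0 w0T w0r; pose B := closed_ball_ (fun x => `|x|) y r.
have Bc : closed B by exact: closed_closed_ball_.
have cA : compact (Theta `&` B).
  apply: bounded_closed_compact; last exact: closedI.
  exists (`|y| + r); split=> [|M yM x [_ Bx] /=]; first exact: num_real.
  rewrite (le_trans _ (ltW yM)) // -[x](subKr y).
  by rewrite (le_trans (ler_normB _ _)) // lerD2l.
have A0 : Theta `&` B !=set0.
  by exists w0; split=> //; rewrite /B /closed_ball_ /= distrC.
have [|w wA wmin] := EVT_min_rV A0 cA (f := prox_objective p c s).
  by apply: continuous_subspaceT; exact: prox_objective_continuous.
have [wT wB] : (Theta `&` B) w by rewrite inE in wA.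
have wr : `|w - y| <= r by rewrite distrC.
exists w; split=> //.
  by apply: wmin; rewrite inE; split=> //; rewrite /B /closed_ball_ /= distrC.
move=> wr'; apply: (@proximal_normal _ _ _ _ _ (s / 2) (r - `|w - y|)) => //.
  by rewrite subr_gt0.
move=> x xT xw.
have xA : x \in Theta `&` B.
  rewrite inE; split=> //; rewrite /B /closed_ball_ /= distrC.
  have -> : x - y = (x - w) + (w - y) by rewrite addrA subrK.
  rewrite (le_trans (ler_normD _ _)) // -lerBrDr ltW //.
have := wmin x xA; rewrite /prox_objective.
have -> : x - c = (x - w) + (w - c) by rewrite addrA subrK.
move: (x - w) (w - c) => a b; rewrite !dotW (dotC b a); lra.
Qed.

End Minimization.

Section GraphTangent.
Context {R : realType} {m l : nat} (g : 'rV[R]_m -> 'rV[R]_l).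
Hypothesis g_C2 : C2 g.
Variables (y ys : 'rV[R]_m).
Hypothesis mfcq : MFCQ g y.

(** Adding a small multiple of the Mangasarian-Fromovitz direction to [v] makes
    all active constraints decrease strictly. *)
Lemma linearized_tangent v : Gamma g y ->
  (forall i, active g y i -> dot (grad_g g i y) v <= 0) ->
  tangent_cone (Gamma g) y v.
Proof.
move=> yG vlin; have [v0 v0P] := mfcq; apply: tangent_cone_approx => e e0.
have n0 : 0 < `|v0| + 1 by rewrite ltr_wpDl.
pose k : R := e / (`|v0| + 1).
have k0 : 0 < k by exact: divr_gt0.
have strict i : active g y i -> dot (grad_g g i y) (v + k *: v0) < 0.
  by move=> ai; rewrite !dotW ltr_wnDl ?vlin // pmulr_rlt0 // v0P.
have := @feasible_arc _ _ _ _ g_C2 y (v + k *: v0) 0 yG.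
move=> /(_ (fun i ai => ltW (strict i ai))) arc.
have {}arc : \forall t \near (0 : R)^'+,
    Gamma g (y + (t *: (v + k *: v0) + t ^+ 2 *: 0)).
  by apply: arc => i ai vi; have := strict i ai; rewrite vi ltxx.
have /near0rightP[r r0 rP] := arc.
have m0 : 0 < Num.min e r by rewrite lt_min e0.
have : Num.min e r / 2 < Num.min e r by rewrite ltr_pdivrMr // ltr_pMr // ltr1n.
rewrite lt_min => /andP[te tr].
have t0 : 0 < Num.min e r / 2 by rewrite divr_gt0.
exists (Num.min e r / 2), (v + k *: v0); split; first by rewrite t0.
  rewrite opprD addNKr normrN normrZ gtr0_norm // /k mulrAC ltr_pdivrMr //.
  by rewrite ltr_pM2l // ltrDl.
have := rP (Num.min e r / 2); rewrite t0 tr scaler0 addr0; exact.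
Qed.

(** The minimizer of the proximal objective over [Gamma g], near the point
    [y + t v], is written [y + t v + e]; the purpose of this section is to show
    that [e] is of smaller order than [t]. *)
Section ErrorBound.
Variables (v : 'rV[R]_m) (lam : 'rV[R]_l) (mu : 'I_l -> R).
Hypothesis lamM : multipliers g y ys lam.
Hypothesis ys_v : dot ys v = 0.
Hypothesis muP : forall i, mu i != 0 -> [/\ active g y i,
  dot (grad_g g i y) v = 0 & 0 <= mu i \/ Iplus g y ys i].

Let H := hess_lag g lam y.
Let w := \sum_i mu i *: grad_g g i y.
Let vs := v *m H + w.
Let c : R := dot (v *m H) v.

(** What is known on the minimizer: it is feasible, the Taylor estimates hold
    there, and its objective does not exceed that of the second-order arc. *)
Let near_min (s eps t : R) (e : 'rV[R]_m) :=
  [/\ 0 < eps <= 1, 0 < t, taylor_at g y eps (t *: v + e),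
      Gamma g (y + (t *: v + e))
    & - dot (ys + t *: vs) e + s / 2 * dot e e
        <= 2^-1 * (t ^+ 2 * c) + eps * t ^+ 2].

(** The quadratic scale in which all error terms are measured. *)
Let N (t : R) (e : 'rV[R]_m) : R := t ^+ 2 + dot e e.
Let A : R := 2 * (dot v v + 1).

Let sqr_h_le t e : dot (t *: v + e) (t *: v + e) <= A * N t e.
Proof.
apply: le_trans (dot_sqrD _ _) _; rewrite !dotW /A /N.
have := dot_ge0 v; have := dot_ge0 e; have := sqr_ge0 t.
move=> t2 e2 v2.
have := mulr_ge0 v2 e2; have := mulr_ge0 v2 t2; move: (dot v v) (dot e e).
by move=> p q; lra.
Qed.

Let active_upper i : active g y i -> exists2 K : R, 0 <= K &
  forall s eps t e, near_min s eps t e ->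
    dot (grad_g g i y) (t *: v + e) <= K * N t e.
Proof.
move=> ai; have [k k0 kP] := quad_form_bounded (hess (fun z => g z 0 i) y).
have A0 : 0 <= A by rewrite mulr_ge0 // addr_ge0 // dot_ge0.
exists ((k + 1) * A); first by rewrite mulr_ge0 // addr_ge0 // ltW.
move=> s eps t e [/andP[eps0 eps1] t0 /(_ i) tay yh _].
move: tay (yh i) (kP (t *: v + e)) (sqr_h_le t e) (dot_ge0 (t *: v + e)).
rewrite ai; set h := t *: v + e; set q := dot (h *m _) h.
move: (dot (grad_g g i y) h) (g (y + h) 0 i) (dot h h) => a b hh.
rewrite !ler_norml => /andP[tay _] b0 /andP[kq _] hA hh0.
have e1 : eps * hh <= hh by rewrite ler_piMl.
have k1 : 0 <= k * hh by rewrite mulr_ge0 // ltW.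
have h1 : (k + 1) * hh <= (k + 1) * (A * N t e).
  by rewrite ler_wpM2l // addr_ge0 // ltW.
by rewrite -mulrA; lra.
Qed.

(** The comparison with the second-order arc also bounds the decrease of the
    linear form [ys], which vanishes to first order along [v]. *)
Let ys_upper : exists2 K : R, 0 <= K &
  forall s eps t e, 0 <= s -> near_min s eps t e -> - dot ys e <= K * N t e.
Proof.
exists (dot vs vs + `|c| + 2); first by rewrite !addr_ge0 // dot_ge0.
move=> s eps t e s0 [/andP[eps0 eps1] t0 _ _]; rewrite dotDl dotZl => obj.
have := dot_young t vs e; have := ler_norm (dot vs e); have := ler_norm c.
move=> c1 n1 yg.
have t2 := sqr_ge0 t; have e2 := dot_ge0 e; have v2 := dot_ge0 vs.
have q1 := ler_wpM2l (ltW t0) n1; have q2 := ler_wpM2l t2 c1.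
have q3 := mulr_ge0 s0 e2; have q4 := ler_wpM2r t2 eps1.
have q5 := mulr_ge0 v2 e2; have q6 := mulr_ge0 (normr_ge0 c) e2.
have q7 := mulr_ge0 v2 t2; have q8 := mulr_ge0 (normr_ge0 c) t2.
rewrite /N; move: (dot vs e) `|dot vs e| (dot ys e) (dot e e) (dot vs vs) `|c| c
  obj yg q1 q2 q3 q4 q5 q6 q7 q8 e2 v2 => a a' b ee vv c' c0; lra.
Qed.

(** A constraint with a positive multiplier [la] cannot become very negative:
    [ys] is a combination of gradients with weights [la], every other term of
    which is bounded above, while the sum is bounded below by the comparison. *)
Let Iplus_lower i : Iplus g y ys i -> exists2 K : R, 0 <= K &
  forall s eps t e, 0 <= s -> near_min s eps t e ->
    - dot (grad_g g i y) (t *: v + e) <= K * N t e.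
Proof.
move=> [la laM /= li]; have [_ la0 _ laE] := (multipliersP g_C2 _ _ _).1 laM.
have /choice[K KP] j : exists K : R, 0 <= K /\ (forall s eps t e,
    near_min s eps t e -> la 0 j * dot (grad_g g j y) (t *: v + e) <= K * N t e).
  have [aj|naj] := pselect (active g y j).
    have [K K0 KP] := active_upper aj; exists (la 0 j * K).
    split=> [|s eps t e st]; first exact: mulr_ge0.
    by rewrite -mulrA ler_wpM2l // (KP s eps).
  exists 0; split=> // s eps t e _.
  by rewrite (multiplier_inactive g_C2 laM naj) !mul0r.
have [K' K'0 K'P] := ys_upper.
have sK0 : 0 <= K' + \sum_(j | j != i) K j.
  by rewrite addr_ge0 // sumr_ge0 // => j _; have [] := KP j.
exists ((K' + \sum_(j | j != i) K j) / la 0 i); first by rewrite divr_ge0 // ltW.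
move=> s eps t e s0 st.
have ysh : dot ys (t *: v + e) = dot ys e by rewrite dotDr dotZr ys_v mulr0 add0r.
have ysE h : dot ys h = la 0 i * dot (grad_g g i y) h
    + \sum_(j | j != i) dot (la 0 j *: grad_g g j y) h.
  transitivity (\sum_j dot (la 0 j *: grad_g g j y) h).
    rewrite -laE.
    exact: dot_suml.
  rewrite [LHS](bigD1 i) //.
  by congr (_ + _); rewrite dotZl.
have := K'P s eps t e s0 st; rewrite -ysh ysE => up.
rewrite mulrAC ler_pdivlMr // mulNr mulrC mulrDl mulr_suml.
have : \sum_(j | j != i) dot (la 0 j *: grad_g g j y) (t *: v + e)
    <= \sum_(j | j != i) K j * N t e.
  by apply: ler_sum => j _; rewrite dotZl; have [_ KjP] := KP j; apply: KjP st.
move: up; set a := la 0 i * _; set b := \sum_(j | _) dot _ _.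
by set b' := \sum_(j | _) _; move: (K' * _) => q; lra.
Qed.

(** The normal component [w] of the prescribed direction satisfies [w e <= O(N)]
    because each gradient occurring in it is orthogonal to [v], hence acts on [e]
    as on the whole displacement. *)
Let w_upper : exists2 K : R, 0 <= K &
  forall s eps t e, 0 <= s -> near_min s eps t e -> dot w e <= K * N t e.
Proof.
have /choice[K KP] i : exists K : R, 0 <= K /\ (forall s eps t e, 0 <= s ->
    near_min s eps t e -> mu i * dot (grad_g g i y) e <= K * N t e).
  have [mui0|mui] := eqVneq (mu i) 0.
    by exists 0; split=> // s eps t e _ _; rewrite mui0 !mul0r.
  have [ai vi sgn] := muP mui.
  have eh t e : dot (grad_g g i y) e = dot (grad_g g i y) (t *: v + e).
    by rewrite dotDr dotZr vi mulr0 add0r.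
  have [mu0|mu0] := leP 0 (mu i).
    have [K K0 KP] := active_upper ai; exists (mu i * K).
    split=> [|s eps t e s0 st]; first exact: mulr_ge0.
    by rewrite -mulrA ler_wpM2l // (eh t) (KP s eps).
  have ip : Iplus g y ys i by case: sgn => // /le_lt_trans/(_ mu0); rewrite ltxx.
  have [K K0 KP] := Iplus_lower ip; exists (- mu i * K).
  have mu0' : 0 <= - mu i by rewrite oppr_ge0 ltW.
  split=> [|s eps t e s0 st]; first exact: mulr_ge0.
  by rewrite -mulrA -mulrNN ler_wpM2l // (eh t) (KP s eps).
exists (\sum_i K i); first by rewrite sumr_ge0 // => i _; have [] := KP i.
move=> s eps t e s0 st; rewrite dot_suml mulr_suml.
by apply: ler_sum => i _; rewrite dotZl; have [_ KiP] := KP i; apply: KiP st.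
Qed.

(** The Lagrangian with multiplier [lam] is nonpositive on [Gamma g] and vanishes
    at [y], so its Taylor expansion bounds [ys] from above by the curvature. *)
Let lagrangian_lower : exists2 K : R, 0 <= K &
  forall s eps t e, near_min s eps t e ->
    dot ys (t *: v + e) + 2^-1 * dot ((t *: v + e) *m H) (t *: v + e)
      <= K * (eps * N t e).
Proof.
have [_ lam0 compl lamE] := (multipliersP g_C2 _ _ _).1 lamM.
have L0 : 0 <= \sum_i lam 0 i by rewrite sumr_ge0.
have A0 : 0 <= A by rewrite mulr_ge0 // addr_ge0 // dot_ge0.
exists ((\sum_i lam 0 i) * A); first exact: mulr_ge0.
move=> s eps t e [/andP[eps0 eps1] t0 tay yh _].
have hA := sqr_h_le t e; set h := t *: v + e in tay yh hA *.
apply: (@le_trans _ _ ((\sum_i lam 0 i) * (eps * dot h h))); last first.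
  by rewrite -mulrA ler_wpM2l // mulrCA ler_wpM2l // ltW.
rewrite -lamE dot_suml /H hess_lagE // mulmx_sumr dot_suml mulr_sumr mulr_suml.
rewrite -big_split /=; apply: ler_sum => i _.
rewrite -scalemxAr !dotZl mulrCA -mulrDr.
have := tay i; rewrite ler_norml => /andP[lo _].
have p0 : lam 0 i * g (y + h) 0 i <= 0 by rewrite mulr_ge0_le0 //; exact: yh.
have := ler_wpM2l (lam0 i) lo; have := compl i.
rewrite !mulrDr !mulrN; move: p0; set p := lam 0 i * _.
by set q := lam 0 i * g y 0 i; lra.
Qed.

(** Objective and curvature cancel up to the linear term [t * dot w e], which is
    of order [t * N], and a positive quadratic form in [e]: the weight [k + 2]
    of the proximal term dominates the curvature of the Lagrangian. *)
Lemma arc_error_bound : exists s C : R, [/\ 0 < s, 0 < C &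
  forall eps t e, near_min s eps t e -> dot e e <= C * (eps + t) * N t e].
Proof.
have [k k0 kP] := quad_form_bounded H.
have [K1 K10 K1P] := w_upper; have [K2 K20 K2P] := lagrangian_lower.
exists (k + 2), (K1 + K2 + 1).
have s0 : 0 < k + 2 by rewrite addr_gt0.
have C0 : 0 < K1 + K2 + 1 by rewrite ltr_wpDl // addr_ge0.
split=> // eps t e st.
have we := K1P _ _ _ _ (ltW s0) st; have lag := K2P _ _ _ _ st.
have [/andP[eps0 eps1] t0 _ _ obj] := st.
have := kP e; rewrite ler_norml => /andP[ke _].
have tw := ler_wpM2l (ltW t0) we.
have HS : H^T = H by exact: hess_lag_sym.
have quadE : dot ((t *: v + e) *m H) (t *: v + e)
    = t ^+ 2 * c + 2 * (t * dot (v *m H) e) + dot (e *m H) e.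
  rewrite mulmxDl -scalemxAl !dotW.
  have -> : dot (e *m H) v = dot (v *m H) e by rewrite dot_mulmx HS dotC.
  by rewrite /c; ring.
move: lag; rewrite quadE dotDr dotZr ys_v mulr0 add0r => lag.
move: obj; rewrite dotDl dotZl /vs dotDl => obj.
have N0 : 0 <= N t e by rewrite addr_ge0 ?sqr_ge0 // dot_ge0.
have e2 := dot_ge0 e.
have q1 : eps * t ^+ 2 <= eps * N t e by rewrite ler_wpM2l ?(ltW eps0) // lerDl.
have q2 := mulr_ge0 K10 (mulr_ge0 (ltW eps0) N0).
have q3 := mulr_ge0 K20 (mulr_ge0 (ltW t0) N0).
have q4 := mulr_ge0 (ltW t0) N0.
move: (N t e) N0 q1 q2 q3 q4 tw lag obj ke e2 => n N0.
move: (dot w e) (dot (v *m H) e) (dot (e *m H) e) (dot ys e) (dot e e) c.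
by move=> a b d f ee c' q1 q2 q3 q4 tw lag obj ke e2; lra.
Qed.

End ErrorBound.

(** The residual of the projection of [y + t v + s^-1 (ys + t vs)] onto [Gamma g]
    is the normal [ys + t vs - s e] at [y + t v + e]. Since [e] is o(t), these
    points of the graph are tangent to the direction [(v, vs)]. The multipliers
    of the projected points need not be identified, so that linearly dependent
    active gradients cause no difficulty. *)
Lemma gphN_tangent v lam (mu : 'I_l -> R) :
  dir_multipliers g y ys v lam -> dot ys v = 0 ->
  (forall i, active g y i -> dot (grad_g g i y) v <= 0) ->
  (forall i, mu i != 0 -> [/\ active g y i, dot (grad_g g i y) v = 0
     & 0 <= mu i \/ Iplus g y ys i]) ->
  tangent_cone (gphN g) (row_mx y ys)
    (row_mx v (v *m hess_lag g lam y + \sum_i mu i *: grad_g g i y)).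
Proof.
move=> lam_dir ys_v vlin muP; have [lamM _] := lam_dir.
have [z zlin zobj] := second_order_correction g_C2 lam_dir.
have [v0 v0P] := mfcq; have [yG _ _ _] := (multipliersP g_C2 _ _ _).1 lamM.
have [s [C [s0 C0 errP]]] := arc_error_bound lamM ys_v muP.
set vs := v *m _ + _ in errP *; set c : R := dot (v *m _) v in zobj errP.
apply: tangent_cone_approx => e0 e00.
have s2 : 0 < 1 + s ^+ 2 by rewrite ltr_pwDl // sqr_ge0.
(* With [C * (eps + t) <= th] the error bound gives [dot e e <= 2 th t^2], and the
   second bound on [th] turns this into the required accuracy [e0]. *)
pose th : R := Num.min 2^-1 (e0 ^+ 2 / (4 * (1 + s ^+ 2))).
have th0 : 0 < th.
  by rewrite lt_min invr_gt0 ltr0n divr_gt0 ?exprn_gt0 // mulr_gt0.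
have th2 : th <= 2^-1 by rewrite ge_min lexx.
have ths : th * (4 * (1 + s ^+ 2)) <= e0 ^+ 2.
  by rewrite -ler_pdivlMr ?mulr_gt0 // ge_min lexx orbT.
pose eps : R := Num.min 1 (th / (2 * C)).
have C20 : 0 < 2 * C by rewrite mulr_gt0.
have eps0 : 0 < eps by rewrite lt_min ltr01 divr_gt0.
have eps1 : eps <= 1 by rewrite ge_min lexx.
have epsC : eps * (2 * C) <= th.
  by rewrite -ler_pdivlMr // ge_min lexx orbT.
have [r r0 tay] := constraint_taylor g_C2 y eps0.
pose r' : R := r / 2; have r'0 : 0 < r' by rewrite divr_gt0.
have r'r : r' < r by rewrite /r' ltr_pdivrMr // ltr_pMr // ltr1n.
have n0 : 0 < 2 * (`|dot ys v0| + 1) by rewrite mulr_gt0 // ltr_wpDl.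
pose k : R := eps / (2 * (`|dot ys v0| + 1)).
have k0 : 0 < k by exact: divr_gt0.
pose d := 2^-1 *: z + k *: v0.
have dobj : - dot ys d <= 2^-1 * c + eps / 2.
  have kv : k * `|dot ys v0| <= eps / 2.
    rewrite /k invfM mulrA mulrAC ler_pdivrMr ?ltr_wpDl // ler_wpM2l ?lerDl //.
    by rewrite divr_ge0 // ltW.
  have kv' : - (k * dot ys v0) <= k * `|dot ys v0|.
    by rewrite -mulrN ler_wpM2l ?(ltW k0) // -normrN ler_norm.
  by rewrite /d !dotW; lra.
have dlin i : active g y i -> dot (grad_g g i y) v = 0 ->
    dot (grad_g g i y) d + 2^-1 * dot (v *m hess (fun z => g z 0 i) y) v < 0.
  move=> ai _; rewrite /d !dotW.
  have kv : k * dot (grad_g g i y) v0 < 0 by rewrite pmulr_rlt0 // v0P.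
  by have := zlin i ai; lra.
have arc := feasible_arc g_C2 yG vlin dlin.
have e20 : 0 < eps / 2 by rewrite divr_gt0.
clearbody d vs c.
(* It suffices to find graph points with a relative error below [e0], the error
   being [(e, - s e)] with [e = w - (y + t v)]. *)
suff [t [w [t0 te wG wN ew]]] : exists t w, [/\ 0 < t, t < e0, Gamma g w,
    regular_normal_cone (Gamma g) w (ys + t *: vs - s *: (w - (y + t *: v)))
  & dot (w - (y + t *: v)) (w - (y + t *: v)) * (1 + s ^+ 2)
      < (t * e0) ^+ 2].
  pose e := w - (y + t *: v).
  have tn0 : t != 0 by rewrite gt_eqF.
  exists t, (row_mx v vs + row_mx (t^-1 *: e) (- (s * t^-1) *: e)); split.
  - by rewrite t0.
  - rewrite opprD addNKr normrN; apply: norm_lt_dot => //.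
    rewrite dot_row_mx !dotZl !dotZr.
    move: ew; rewrite exprMn -ltr_pdivrMl ?exprn_gt0 // => ew.
    apply: le_lt_trans ew; rewrite -/e -exprVn le_eqVlt.
    by apply/orP; left; apply/eqP; ring.
  - rewrite add_row_mx scale_row_mx add_row_mx /gphN /=.
    rewrite row_mxKl row_mxKr (scalerDr t v) (scalerDr t vs).
    have -> : y + (t *: v + t *: (t^-1 *: e)) = w.
      by rewrite scalerA mulfV // scale1r addrA /e addrC subrK.
    have -> : ys + (t *: vs + t *: (- (s * t^-1) *: e)) = ys + t *: vs - s *: e.
      by rewrite scalerA mulrN mulrCA mulfV // mulr1 scaleNr addrA.
    exact: wN.
pose near_ok (t : R) := [/\ 0 < t, t < e0, 2 * C * t <= th,
  t * (`|v| + 1) < r' & exists w, [/\ Gamma g w, `|w - y| <= r',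
    prox_objective (ys + t *: vs) (y + t *: v) s w
      <= 2^-1 * (t ^+ 2 * c) + eps * t ^+ 2
  & `|w - y| < r' -> regular_normal_cone (Gamma g) w
      (ys + t *: vs - s *: (w - (y + t *: v)))]].
have [t [t0 te tC tr' [w [wG wr wobj wN]]]] : exists t, near_ok t.
  have near_ok_near : \forall t \near (0 : R)^'+, near_ok t.
    near=> t.
    have t0 : 0 < t by near: t; exact: nbhs_right_gt.
    have te : t < e0 by near: t; exact: nbhs_right_lt.
    have tC : t * (2 * C) < th by near: t; exact: near0_mul_lt.
    have tr' : t * (`|v| + 1) < r' by near: t; exact: near0_mul_lt.
    split; [exact: t0|exact: te|by rewrite mulrC ltW|exact: tr'|].
    have arc_r : `|t *: v + t ^+ 2 *: d| < r' by near: t; exact: near0_arc_small.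
    have arcG : Gamma g (y + (t *: v + t ^+ 2 *: d)) by near: t; exact: arc.
    have t1 : t < 1 by near: t; exact: nbhs_right_lt.
    have tk : t * (`|dot vs d| + s / 2 * dot d d) < eps / 2.
      by near: t; exact: near0_mul_lt.
    have [|w [wG wr wobj wN]] := @prox_minimizer _ _ (Gamma g) y (ys + t *: vs)
      (y + t *: v) _ s r' (Gamma_closed g_C2) r'0 arcG.
      by rewrite addrC addKr ltW.
    exists w; split=> //; apply: le_trans wobj _.
    rewrite /prox_objective addrA [y + t *: v + _]addrC addrK !dotW.
    have q1 := ler_norm (- dot vs d); rewrite normrN in q1.
    have t2 := sqr_ge0 t.
    have q2 := ler_wpM2l t2 (ltW tk); have q3 := ler_wpM2l t2 dobj.
    have q4 := ler_wpM2l (mulr_ge0 (ltW t0) t2) q1.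
    have q5 : t ^+ 2 * (t ^+ 2 * (s / 2 * dot d d))
       <= t ^+ 2 * (t * (s / 2 * dot d d)).
      rewrite ler_wpM2l // ler_wpM2r //; last by rewrite expr2 ler_piMl // ltW.
      by rewrite mulr_ge0 ?dot_ge0 // divr_ge0 // ltW.
    move: (dot ys d) (dot vs d) (dot d d) q2 q3 q4 q5 => a b dd; clear.
    by move: `|b| => b' q2 q3 q4 q5; lra.
  by have [r1 r10 r1P] := (near0rightP _).1 near_ok_near; exists (r1 / 2);
     apply: r1P; rewrite divr_gt0 //= ltr_pdivrMr // ltr_pMr // ltr1n.
pose e := w - (y + t *: v).
have he : w - y = t *: v + e by rewrite /e opprD addrCA subrKC.
have wE : w = y + (t *: v + e) by rewrite -he addrC subrK.
have hr : `|t *: v + e| < r by rewrite -he (le_lt_trans wr).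
have err : dot e e <= C * (eps + t) * (t ^+ 2 + dot e e).
  apply: errP; split=> //; first by rewrite eps0.
  - exact: tay.
  - by rewrite -wE.
have e2 := dot_ge0 e; have t2 : 0 < t ^+ 2 by exact: exprn_gt0.
have Cth : C * (eps + t) <= th by lra.
have ee : dot e e <= 2 * th * t ^+ 2.
  have := ler_wpM2r (addr_ge0 (ltW t2) e2) Cth.
  have := ler_wpM2r e2 th2; lra.
have en : `|e| <= t.
  rewrite -(@ler_pXn2r _ 2) ?nnegrE ?(ltW t0) //.
  apply: le_trans (sqr_norm_le_dot e) _; apply: le_trans ee _.
  by rewrite ler_piMl ?(ltW t2) // mulrC -ler_pdivlMr // mul1r.
exists t, w; split=> //.
  apply: wN; rewrite he (le_lt_trans _ tr') // (le_trans (ler_normD _ _)) //.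
  by rewrite normrZ gtr0_norm // mulrDr mulr1 lerD2l.
rewrite -/e exprMn.
have q1 := ler_wpM2r (ltW s2) ee.
have q2 := ler_wpM2l (ltW t2) ths.
have q3 : 0 < t ^+ 2 * e0 ^+ 2 by rewrite mulr_gt0 // exprn_gt0.
have q4 : 2 * th * t ^+ 2 * (1 + s ^+ 2) = 2^-1 * (t ^+ 2 * (th * (4 * (1 + s ^+ 2)))).
  by field.
rewrite q4 in q1; lra.
Unshelve. all: by end_near. Qed.

End GraphTangent.

(** * Duality for a convex piece of the linearized problem *)

Section PieceDuality.
Context {R : realType}.

Lemma dot_ext d (a b : 'rV[R]_d) : (forall h, dot a h = dot b h) -> a = b.
Proof. by move=> ab; apply/rowP => i; rewrite -!dot_delta ab. Qed.

(** Because the tangent cone is invariant under positive scalings, the right-hand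
    sides of its inequalities can be replaced by 0. *)
Lemma polyhedral_tangent_cone d (Theta : set 'rV[R]_d) z : Theta z ->
  polyhedral (tangent_cone Theta z) ->
  exists k (A : 'M[R]_(d, k)),
    forall u, tangent_cone Theta z u <-> forall i, (u *m A) 0 i <= 0.
Proof.
move=> zT [k [a [b TE]]]; exists k, (\matrix_i a i)^T => u.
have mulE w i : (w *m (\matrix_i a i)^T) 0 i = dot (a i) w.
  by rewrite mxE dotE; apply: eq_bigr => j _; rewrite !mxE mulrC.
have b0 i : 0 <= b i.
  by have := tangent_cone0 zT; rewrite TE => /(_ i); rewrite dot0r.
split=> [uT i|uA]; last first.
  by rewrite TE => i; rewrite -mulE (le_trans (uA i)).
rewrite mulE leNgt; apply/negP => aiu.
have t0 : 0 < (b i + 1) / dot (a i) u by rewrite divr_gt0 // ltr_wpDl.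
have := tangent_coneZ t0 uT; rewrite TE => /(_ i).
by rewrite dotZr divfK ?gt_eqF // gerDl ler10.
Qed.

(** Right multiplication by [indic_mx S] keeps the columns in [S]: it lets matrices
    express systems whose inequalities and equations depend on an index set. *)
Definition indic_mx l (S : set 'I_l) : 'M[R]_l := diag_mx (\row_i (i \in S)%:R).

Lemma mul_indic_mx l (S : set 'I_l) (u : 'rV[R]_l) i :
  (u *m indic_mx S) 0 i = u 0 i * (i \in S)%:R.
Proof. by rewrite mul_mx_diag !mxE. Qed.

Lemma tr_indic_mx l (S : set 'I_l) : (indic_mx S)^T = indic_mx S.
Proof. exact: tr_diag_mx. Qed.

(** Farkas' lemma for the convex piece of the linearized problem that belongs to a
    choice of signs: [P] carries the indices with a vanishing constraint and a
    free multiplier, [B] those with a vanishing constraint and a nonnegative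
    multiplier, [Z] those with a nonpositive constraint and a vanishing
    multiplier; the duality exchanges [B] and [Z]. The vector [- q] is the
    multiplier of the vector equation. *)
Lemma piece_duality n m l k (A : 'M[R]_(n, k)) (Jx : 'M[R]_(n, m))
    (Jy H : 'M[R]_m) (D : 'M[R]_(m, l)) (P B Z : set 'I_l)
    (p1 : 'rV[R]_n) (p2 : 'rV[R]_m) :
  P `&` B = set0 -> Z `&` (P `|` B) = set0 ->
  (forall (u : 'rV[R]_n) (v : 'rV[R]_m) (mu : 'rV[R]_l),
     (forall i, (u *m A) 0 i <= 0) ->
     (forall i, (P `|` B) i -> (v *m D) 0 i = 0) ->
     (forall i, Z i -> (v *m D) 0 i <= 0) ->
     (forall i, B i -> 0 <= mu 0 i) ->
     (forall i, ~ (P `|` B) i -> mu 0 i = 0) ->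
     - (u *m Jx + v *m Jy) = v *m H + mu *m D^T ->
     dot p1 u + dot p2 v <= 0) ->
  exists (al : 'rV[R]_k) (q : 'rV[R]_m) (mu : 'rV[R]_l),
    [/\ forall i, 0 <= al 0 i,
        p1 = al *m A^T - q *m Jx^T,
        p2 = (mu *m D^T - q *m H^T) - q *m Jy^T,
        [/\ forall i, P i -> (q *m D) 0 i = 0,
            forall i, B i -> (q *m D) 0 i <= 0
          & forall i, Z i -> 0 <= mu 0 i]
      & forall i, ~ (P `|` B `|` Z) i -> mu 0 i = 0].
Proof.
move=> PB ZPB polar; pose F := P `|` B.
pose MA := col_mx (row_mx A 0)
  (col_mx (row_mx 0 (row_mx (D *m indic_mx Z) 0))
          (row_mx 0 (row_mx 0 (- indic_mx B)))).
pose MB := col_mx (row_mx Jx 0)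
  (col_mx (row_mx (Jy + H) (row_mx (D *m indic_mx F) 0))
          (row_mx D^T (row_mx 0 (indic_mx (~` F))))).
have [x|la [ka [la0 laE]]] := @farkas_mixed _ _ _ _ MA MB (row_mx p1 (row_mx p2 0)).
  rewrite -[x]hsubmxK -[rsubmx x]hsubmxK.
  move: (lsubmx x) (lsubmx (rsubmx x)) (rsubmx (rsubmx x)) => u v mu.
  rewrite !mul_row_col !mul_mx_row !mulmx0 !add_row_mx !add0r !addr0 mulmxN.
  move=> xA xB; rewrite !dot_row_mx dot0l addr0; apply: (polar u v mu).
  - by move=> i; have := xA (lshift _ i); rewrite row_mxEl.
  - move=> i Fi; have /rowP/(_ (rshift _ (lshift _ i))) := xB.
    rewrite row_mxEr row_mxEl mulmxA mul_indic_mx mem_set // mulr1 => ->.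
    by rewrite mxE.
  - move=> i Zi; have := xA (rshift _ (lshift _ i)).
    by rewrite row_mxEr row_mxEl mulmxA mul_indic_mx mem_set // mulr1.
  - move=> i Bi; have := xA (rshift _ (rshift _ i)).
    by rewrite !row_mxEr mxE mul_indic_mx mem_set // mulr1 oppr_le0.
  - move=> i Fi; have /rowP/(_ (rshift _ (rshift _ i))) := xB.
    by rewrite !row_mxEr mul_indic_mx mem_set // mulr1 mxE.
  - have : u *m Jx + (v *m (Jy + H) + mu *m D^T) = 0.
      apply/rowP => j; have /rowP/(_ (lshift _ j)) := xB.
      by rewrite row_mxEl => ->; rewrite !mxE.
    rewrite mulmxDr !addrA -addrA => /eqP; rewrite addr_eq0 => /eqP ->.
    by rewrite opprK.
pose al := lsubmx la; pose rho := lsubmx (rsubmx la); pose tau := rsubmx (rsubmx la).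
pose q := lsubmx ka; pose ka' := lsubmx (rsubmx ka); pose ze := rsubmx (rsubmx ka).
have tau0 i : 0 <= tau 0 i by rewrite !mxE.
have rho0 i : 0 <= rho 0 i by rewrite !mxE.
have al0 i : 0 <= al 0 i by rewrite !mxE.
move: laE; rewrite -[la]hsubmxK -[rsubmx la]hsubmxK -[ka]hsubmxK -[rsubmx ka]hsubmxK.
rewrite -/al -/rho -/tau -/q -/ka' -/ze.
clearbody al rho tau q ka' ze.
rewrite !tr_col_mx !tr_row_mx !mul_mx_row !mul_row_col !trmx0 !mulmx0.
rewrite !add0r !addr0 !add_row_mx => /eq_row_mx[p1E /eq_row_mx[p2E qDE]].
pose mu := rho *m indic_mx Z + ka' *m indic_mx F.
have muE i : mu 0 i = rho 0 i * (i \in Z)%:R + ka' 0 i * (i \in F)%:R.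
  by rewrite mxE !mul_indic_mx.
have qD i : (q *m D) 0 i = tau 0 i * (i \in B)%:R - ze 0 i * (i \in ~` F)%:R.
  have /rowP/(_ i) := qDE; rewrite trmxK linearN /= !tr_indic_mx mulmxN.
  rewrite [LHS]mxE [RHS]mxE [X in X + _]mxE [X in _ + X]mxE !mul_indic_mx => h.
  by lra.
have disj i : F i -> ~ Z i by move=> Fi Zi; have : (Z `&` F) i by []; rewrite ZPB.
exists al, (- q), mu; split=> //.
- by rewrite p1E mulNmx opprK.
- rewrite p2E !mulNmx !opprK [(Jy + H)^T]linearD /= !trmx_mul !tr_indic_mx.
  rewrite /mu mulmxDl mulmxDr !mulmxA.
  move: (rho *m _ *m _) (ka' *m _ *m _) (q *m _) (q *m _) => a b c d.
  by apply/rowP => i; rewrite !mxE; ring.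
- have nqD i : (- q *m D) 0 i
      = ze 0 i * (i \in ~` F)%:R - tau 0 i * (i \in B)%:R.
    by rewrite mulNmx [LHS]mxE qD opprB.
  have notFc i : F i -> (i \in ~` F) = false by move=> Fi; exact: memNset.
  split=> i.
  + move=> Pi; rewrite nqD notFc; last by left.
    rewrite memNset ?mulr0 ?subrr // => Bi.
    by have : (P `&` B) i by []; rewrite PB.
  + move=> Bi; rewrite nqD notFc; last by right.
    by rewrite mem_set // mulr0 sub0r mulr1 oppr_le0.
  + move=> Zi; rewrite muE mem_set // (_ : (i \in F) = false) ?mulr0 ?addr0 ?mulr1 //.
    by apply: memNset => /disj.
- move=> i; rewrite muE => nF; rewrite !memNset ?mulr0 ?addr0 //.
    by move=> Fi; apply: nF; left.
  by move=> Zi; apply: nF; right.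
Qed.

End PieceDuality.

(** * The generalized equation *)

Section GeneralizedEquation.
Context {R : realType} {n m l : nat}.
Variables (G : 'rV[R]_(n + m) -> 'rV[R]_m).
Hypothesis G_diff : forall z, differentiable G z.
Variables (x : 'rV[R]_n) (y : 'rV[R]_m).

Lemma diff_G u v :
  'd G (row_mx x y) (row_mx u v) = u *m JxG G x y + v *m JyG G x y.
Proof.
have dG := G_diff (row_mx x y).
have JxE : u *m JxG G x y = 'd G (row_mx x y) (row_mx u 0).
  pose f (x' : 'rV[R]_n) := x' *m row_mx 1%:M 0 + cst (row_mx 0 y) x'.
  have fE x' : f x' = row_mx x' y.
    by rewrite /f mul_mx_row mulmx1 mulmx0 add_row_mx addr0 add0r.
  have df : is_diff x f ((fun x' => x' *m row_mx 1%:M 0) + 0).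
    by apply: is_diffD; exact: diff_mulmx.
  have dGf : differentiable G (f x) by rewrite fE.
  rewrite /JxG jacobianE.
  have -> : (fun x' => G (row_mx x' y)) = G \o f by apply/funext => x' /=; rewrite fE.
  rewrite diff_comp //= diff_val fE /= fctE /= mul_mx_row mulmx1 mulmx0.
  by rewrite addr0.
have JyE : v *m JyG G x y = 'd G (row_mx x y) (row_mx 0 v).
  pose f (y' : 'rV[R]_m) := y' *m row_mx 0 1%:M + cst (row_mx x 0) y'.
  have fE y' : f y' = row_mx x y'.
    by rewrite /f mul_mx_row mulmx1 mulmx0 add_row_mx addr0 add0r.
  have df : is_diff y f ((fun y' => y' *m row_mx 0 1%:M) + 0).
    by apply: is_diffD; exact: diff_mulmx.
  have dGf : differentiable G (f y) by rewrite fE.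
  rewrite /JyG jacobianE.
  have -> : (fun y' => G (row_mx x y')) = G \o f by apply/funext => y' /=; rewrite fE.
  rewrite diff_comp //= diff_val fE /= fctE /= mul_mx_row mulmx1 mulmx0.
  by rewrite addr0.
by rewrite JxE JyE -linearD add_row_mx addr0 add0r.
Qed.

Lemma diff_FGE z w :
  'd (FGE G) z w = row_mx (lsubmx w) (row_mx (rsubmx w) (- 'd G z w)).
Proof.
pose P : 'M[R]_(n + m, n + (m + m)) :=
  row_mx (col_mx 1%:M 0) (row_mx (col_mx 0 1%:M) 0).
pose Q : 'M[R]_(m, n + (m + m)) := row_mx 0 (row_mx 0 (- 1%:M)).
have PE u : u *m P = row_mx (lsubmx u) (row_mx (rsubmx u) 0).
  rewrite -{1}[u]hsubmxK /P !mul_mx_row !mul_row_col !mulmx1 !mulmx0.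
  by rewrite addr0 add0r.
have QE u : u *m Q = row_mx 0 (row_mx 0 (- u)).
  by rewrite /Q !mul_mx_row !mulmx0 mulmxN mulmx1.
have FE : FGE G = (fun u => u *m P) + (fun u => G u *m Q).
  apply/funext => u; rewrite fctE /= PE QE !add_row_mx !addr0 !add0r.
  by [].
have dG := G_diff z.
have dQ := diff_mulmx Q (G z); have dP := diff_mulmx P z.
have dGQ : differentiable (fun u => G u *m Q) z.
  exact: (differentiable_comp dG (@ex_diff _ _ _ _ _ _ _ dQ)).
have dPd : differentiable (fun u : 'rV[R]_(n + m) => u *m P) z by exact: ex_diff.
have sum_rule : 'd (FGE G) z w
    = 'd (fun u : 'rV[R]_(n + m) => u *m P) z w + 'd (fun u => G u *m Q) z w.
  rewrite FE; exact: (congr1 (@^~ w) (diffD dPd dGQ)).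
have dPw : 'd (fun u : 'rV[R]_(n + m) => u *m P) z w = w *m P.
  exact: (congr1 (@^~ w) (@diff_val _ _ _ _ _ _ _ dP)).
have dQw := diff_comp_mulmx Q w dG.
transitivity (w *m P + 'd G z w *m Q).
  by apply: etrans sum_rule _; congr (_ + _).
by rewrite PE QE !add_row_mx !addr0 !add0r.
Qed.

Lemma adjoint_FGE (eta : 'rV[R]_n) (qs q : 'rV[R]_m) :
  row_mx eta (row_mx qs q) *m ('J (FGE G) (row_mx x y))^T
  = row_mx (eta - q *m (JxG G x y)^T) (qs - q *m (JyG G x y)^T).
Proof.
apply: dot_ext => h; rewrite dot_mulmx trmxK jacobianE diff_FGE -[h]hsubmxK.
rewrite diff_G row_mxKl row_mxKr !dot_row_mx !dotW.
by rewrite (dot_mulmx q (JxG G x y)^T) (dot_mulmx q (JyG G x y)^T) !trmxK; ring.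
Qed.

Variables (C : set 'rV[R]_n) (g : 'rV[R]_m -> 'rV[R]_l).
Hypothesis g_C2 : C2 g.
Let ys := - G (row_mx x y).
Hypothesis feasible : OmegaGE G C g (row_mx x y).
Hypothesis TD_prod : tangent_cone (DGE C g) (FGE G (row_mx x y)) =
  prodset (tangent_cone C x) (tangent_cone (gphN g) (row_mx y ys)).
Hypothesis ggcq : GGCQ G C g (row_mx x y).
Hypothesis mfcq : MFCQ g y.
Hypothesis TC_polyhedral : polyhedral (tangent_cone C x).
Variable lam : 'rV[R]_l.
Hypothesis lamM : multipliers g y ys lam.
Hypothesis lam_dir : forall v, critical_cone g y ys v -> dir_multipliers g y ys v lam.

Let a i := grad_g g i y.
Let H := hess_lag g lam y.
Let Jx := JxG G x y.
Let Jy := JyG G x y.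

(** The set [beta] selects one convex polyhedral piece of the tangent cone of the
    graph. The constraint qualification turns a regular normal of the feasible
    set into an element of the polar of the linearized cone, hence of the polar
    of the preimage of this piece, which Farkas' lemma computes. *)
Lemma normal_piece (beta : set 'I_l) p :
  beta `<=` Izero g y ys ->
  regular_normal_cone (OmegaGE G C g) (row_mx x y) p ->
  exists eta q (mu : 'I_l -> R),
    [/\ regular_normal_cone C x eta,
        p = row_mx (eta - q *m Jx^T)
          (\sum_(i | i \in active g y) mu i *: a i - q *m H - q *m Jy^T)
      & [/\ forall i, Iplus g y ys i -> dot (a i) q = 0,
            forall i, beta i -> dot (a i) q <= 0
          & forall i, (Izero g y ys `\` beta) i -> 0 <= mu i]].
Proof.
move=> beta0 [_ pN].
have Cx : C x by have [_] := feasible; rewrite row_mxKl.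
have yG : Gamma g y by have [] := (multipliersP g_C2 _ _ _).1 lamM.
have lamE : \sum_i lam 0 i *: a i = ys by have [] := (multipliersP g_C2 _ _ _).1 lamM.
have lam0 i : 0 <= lam 0 i by have [] := (multipliersP g_C2 _ _ _).1 lamM.
have [k [A AP]] := polyhedral_tangent_cone Cx TC_polyhedral.
have DE v i : (v *m 'J g y) 0 i = dot (a i) v.
  by rewrite jacobianE /a grad_gE.
have Ip_act i : Iplus g y ys i -> active g y i by exact: Iplus_active.
pose Z := Izero g y ys `\` beta.
have act_cases i : active g y i -> [\/ Iplus g y ys i, beta i | Z i].
  move=> ai; have [pi|npi] := pselect (Iplus g y ys i); first exact: Or31.
  by have [bi|nbi] := pselect (beta i); [exact: Or32|apply: Or33].
have pP : polar [set w | tangent_cone (DGE C g) (FGE G (row_mx x y))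
    ('d (FGE G) (row_mx x y) w)] p by rewrite -ggcq.
have [||u v mu uA vF vZ muB mu0 dE|al [q [mu [al0 pxE pyE [qP qB muZ] mu0]]]] :=
  @piece_duality _ n m l k A Jx Jy H ('J g y) (Iplus g y ys) beta Z
    (lsubmx p) (rsubmx p).
- by apply/seteqP; split=> // i [pi /beta0[_ npi]].
- by apply/seteqP; split=> // i [[[_ npi] nbi] [/npi|/nbi]].
- rewrite -dot_row_mx hsubmxK; apply: pP; rewrite /= TD_prod diff_FGE diff_G.
  rewrite row_mxKl row_mxKr; split; first by rewrite row_mxKl; exact/AP.
  rewrite row_mxKr -/Jx -/Jy dE mul_tr_jacobian //.
  have vlin i : active g y i -> dot (a i) v <= 0.
    move=> ai; rewrite -DE; have [pi|bi|zi] := act_cases i ai.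
    + by rewrite vF //; left.
    + by rewrite vF //; right.
    + exact: vZ.
  have ysv : dot ys v = 0.
    rewrite -lamE dot_suml big1 // => i _; rewrite dotZl.
    have := lam0 i; rewrite le_eqVlt => /orP[/eqP <-|li]; first by rewrite mul0r.
    by rewrite -DE vF ?mulr0 //; left; exists lam.
  have vcrit : critical_cone g y ys v.
    by split; [exact: linearized_tangent|exact: ysv].
  apply: (gphN_tangent g_C2 mfcq (lam_dir vcrit) ysv vlin) => i mui.
  have Fi : (Iplus g y ys `|` beta) i.
    by apply: contrapT => nF; move/eqP: mui; apply; exact: mu0.
  split; first by case: Fi => [/Ip_act|/beta0[]].
    by rewrite -/(a i) -DE vF.
  by case: Fi => [pi|bi]; [right|left; exact: muB].
exists (al *m A^T), q, (fun i => mu 0 i); split.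
- split=> // u uT; rewrite dot_mulmx trmxK dotE; apply: sumr_le0 => i _.
  by apply: mulr_ge0_le0; [exact: al0|exact: (AP u).1 uT i].
- rewrite -[LHS]hsubmxK {1}pxE pyE; congr row_mx.
  have HS : H^T = H := hess_lag_sym g_C2 lam y.
  have -> : mu *m ('J g y)^T = \sum_(i | i \in active g y) mu 0 i *: a i.
    rewrite (mul_tr_jacobian g_C2) [RHS]big_mkcond; apply: eq_bigr => i _ /=.
    case: ifPn => // /negP nai; rewrite mu0 ?scale0r //.
    by move=> [[/Ip_act|/beta0[]]|[[]]] *; apply: nai; rewrite inE.
  exact: (congr1 (fun M => _ - q *m M - _) HS).
- split=> i Pi.
  + by rewrite -DE qP.
  + by rewrite -DE qB.
  + exact: muZ.
Qed.

(** The same normal has one representation for each of the two pieces; the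
    differences of the multipliers are the auxiliary [r] and [mur]. *)
Lemma normal_cone_sub (beta1 beta2 : set 'I_l) :
  beta1 `<=` Izero g y ys -> beta2 `<=` Izero g y ys ->
  regular_normal_cone (OmegaGE G C g) (row_mx x y) `<=`
    [set w *m ('J (FGE G) (row_mx x y))^T
      | w in NtildeGE G C g x y lam beta1 beta2].
Proof.
move=> b1 b2 p pN.
have [eta1 [q1 [mu1 [etaN1 pE1 [qP1 qb1 muZ1]]]]] := normal_piece b1 pN.
have [eta2 [q2 [mu2 [etaN2 pE2 [qP2 qb2 muZ2]]]]] := normal_piece b2 pN.
pose qs1 := \sum_(i | i \in active g y) mu1 i *: a i - q1 *m H.
exists (row_mx eta1 (row_mx qs1 q1)); last by rewrite adjoint_FGE pE1.
exists eta1, qs1, q1; split=> //.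
have := pE2; rewrite pE1 => /eq_row_mx[xE yE].
exists (q1 - q2), (fun i => mu1 i - mu2 i), mu1; split.
- by rewrite /qs1 subrK.
- by split.
- split=> i Pi.
  + by rewrite dotDr dotNr qP1 // qP2 // subrr.
  + by rewrite dotDr dotNr lerDl oppr_ge0 qb2.
  + by rewrite gerBl muZ2.
- have -> : \sum_(i | i \in active g y) (mu1 i - mu2 i) *: grad_g g i y
      = \sum_(i | i \in active g y) mu1 i *: a i
        - \sum_(i | i \in active g y) mu2 i *: a i.
    by rewrite -sumrB; apply: eq_bigr => i _; rewrite scalerBl.
  move: yE; rewrite -/Jy -/H !mulmxBl.
  move: (\sum_(_ | _) mu1 _ *: _) (\sum_(_ | _) mu2 _ *: _) => s1 s2.
  move: (q1 *m H) (q2 *m H) (q1 *m Jy^T) (q2 *m Jy^T) => c1 c2 d1 d2.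
  move=> /rowP yE; apply/rowP => i; have := yE i; rewrite !mxE; lra.
- exists eta2 => //; rewrite -/Jx mulmxBl.
  move: (q1 *m _) (q2 *m _) xE => c1 c2 /rowP xE.
  by apply/rowP => i; have := xE i; rewrite !mxE; lra.
Qed.

End GeneralizedEquation.

Theorem proposition6 (R : realType) (n m l : nat)
    (G : 'rV[R]_(n + m) -> 'rV[R]_m) (C : set 'rV[R]_n)
    (g : 'rV[R]_m -> 'rV[R]_l)
    (G_C1 : C1 G) (C_closed : closed C) (g_C2 : C2 g)
    (xbar : 'rV[R]_n) (ybar : 'rV[R]_m)
    (feasible : OmegaGE G C g (row_mx xbar ybar))
    (TC_convex : convex_set (tangent_cone C xbar))
    (TD_prod : tangent_cone (DGE C g) (FGE G (row_mx xbar ybar)) =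
       prodset (tangent_cone C xbar)
         (tangent_cone (gphN g) (row_mx ybar (- G (row_mx xbar ybar)))))
    (ggcq : GGCQ G C g (row_mx xbar ybar))
    (mfcq : MFCQ g ybar)
    (TC_polyhedral : polyhedral (tangent_cone C xbar))
    (Lambda_const : forall v1 v2 : 'rV[R]_m,
       critical_cone g ybar (- G (row_mx xbar ybar)) v1 -> v1 <> 0 ->
       critical_cone g ybar (- G (row_mx xbar ybar)) v2 -> v2 <> 0 ->
       dir_multipliers g ybar (- G (row_mx xbar ybar)) v1 =
       dir_multipliers g ybar (- G (row_mx xbar ybar)) v2)
    (lambar : 'rV[R]_l)
    (lambar_dir :
       critical_cone g ybar (- G (row_mx xbar ybar)) <> [set 0] ->
       exists v, [/\ critical_cone g ybar (- G (row_mx xbar ybar)) v, v <> 0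
         & dir_multipliers g ybar (- G (row_mx xbar ybar)) v lambar])
    (lambar_mult :
       critical_cone g ybar (- G (row_mx xbar ybar)) = [set 0] ->
       multipliers g ybar (- G (row_mx xbar ybar)) lambar)
    (beta1 beta2 : set 'I_l)
    (beta1_sub : beta1 `<=` Izero g ybar (- G (row_mx xbar ybar)))
    (beta2_sub : beta2 `<=` Izero g ybar (- G (row_mx xbar ybar))) :
  regular_normal_cone (OmegaGE G C g) (row_mx xbar ybar) `<=`
    [set w *m ('J (FGE G) (row_mx xbar ybar))^T
      | w in NtildeGE G C g xbar ybar lambar beta1 beta2]
  /\
  [set w *m ('J (FGE G) (row_mx xbar ybar))^T
    | w in NtildeGE G C g xbar ybar lambar beta1 beta2] =
  [set p | exists (etaC : 'rV[R]_n) (qs q : 'rV[R]_m),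
     NtildeGE G C g xbar ybar lambar beta1 beta2
       (row_mx etaC (row_mx qs q)) /\
     p = row_mx (etaC - q *m (JxG G xbar ybar)^T)
                (qs - q *m (JyG G xbar ybar)^T)].
Proof.
set ys := - G (row_mx xbar ybar) in Lambda_const lambar_dir lambar_mult
  beta1_sub beta2_sub *.
have G_diff z : differentiable G z by case: G_C1.
have adjoint := adjoint_FGE G_diff xbar ybar.
have lamM : multipliers g ybar ys lambar.
  have [/lambar_mult //|/lambar_dir[v [_ _ []]] //] :=
    pselect (critical_cone g ybar ys = [set 0]).
have lam_dir v : critical_cone g ybar ys v -> dir_multipliers g ybar ys v lambar.
  move=> vK; have [->|/eqP v0] := eqVneq v 0.
    by split=> [|lam' _]; [exact: lamM|rewrite [leLHS]dot0r [leRHS]dot0r].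
  have [|v' [v'K v'0 lam_v']] := lambar_dir.
    by move=> K0; apply: v0; move: vK; rewrite K0.
  by rewrite (Lambda_const v v' vK v0 v'K v'0); exact: lam_v'.
split; first exact: (normal_cone_sub G_diff g_C2 feasible TD_prod ggcq mfcq
  TC_polyhedral lamM lam_dir beta1_sub beta2_sub).
apply/seteqP; split=> p.
  move=> [w wN <-]; have [etaC [qs [q [wE _ _]]]] := wN.
  by exists etaC, qs, q; rewrite -adjoint -wE.
move=> [etaC [qs [q [wN ->]]]]; exists (row_mx etaC (row_mx qs q)) => //.
Qed.
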